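(* Let $p$ and $t$ be integers greater than one, let $G_{pt}=\langle a,b;\ a^p=b^t\rangle$, and let $C_4$ be the number of irreducible components of dimension $4$ of the affine algebraic variety $R(G_{pt})$. Then: (a) $C_4=\dfrac{(p-2)(t-2)+pt}{4}$ if both $p$ and $t$ are even; (b) $C_4=\dfrac{(p-1)(t-1)}{2}$ if either $p$ or $t$ is odd.
   Context: For a finitely generated group $G$, $R(G)$ denotes the set $\mathrm{Hom}(G,SL_2(\mathbb{C}))$ with its structure of affine algebraic variety over $\mathbb{C}$: choosing generators $x_1,\dots,x_n$ of $G$, a homomorphism $\rho$ is identified with the tuple $(\rho(x_1),\dots,\rho(x_n))\in (SL_2(\mathbb{C}))^n$, and $R(G)$ is the Zariski-closed set of tuples so obtained (up to isomorphism it does not depend on the choice of generators). Concretely, for $G_{pt}=\langle a,b;\ a^p=b^t\rangle$, $R(G_{pt})=\{(m_1,m_2)\in SL_2(\mathbb{C})\times SL_2(\mathbb{C}) : m_1^p=m_2^t\}$. The term ''algebraic variety'' does not presuppose irreducibility. The irreducible components of a variety are the maximal irreducible closed subsets in its unique decomposition $V=V_1\cup\dots\cup V_n$. *)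

(* Defs.v *)
From HB Require Import structures.
From mathcomp Require Import all_boot all_order all_algebra.
From mathcomp Require Import boolp classical_sets functions cardinality reals.
From mathcomp Require Import complex.
From mathcomp Require Import mpoly.

Set Implicit Arguments.
Unset Strict Implicit.
Unset Printing Implicit Defensive.

Import GRing.Theory.
Local Open Scope ring_scope.
Local Open Scope classical_set_scope.

(* Finitely presented groups < x_0, ..., x_(n-1) ; u = v for (u, v) in rels >.
   A word is a sequence of letters (i, e), where (i, false) stands for x_i and
   (i, true) for its inverse. *)
Notation word n := (seq ('I_n * bool)).

Definition inv_letter n (l : 'I_n * bool) : 'I_n * bool := (l.1, ~~ l.2).
Definition inv_word n (w : word n) : word n := rev (map (@inv_letter n) w).

Inductive word_cong n (rels : seq (word n * word n)) : word n -> word n -> Prop :=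
| word_cong_refl u : word_cong rels u u
| word_cong_sym u v : word_cong rels u v -> word_cong rels v u
| word_cong_trans u v w :
    word_cong rels u v -> word_cong rels v w -> word_cong rels u w
| word_cong_cat u u' v v' :
    word_cong rels u u' -> word_cong rels v v' ->
    word_cong rels (u ++ v) (u' ++ v')
| word_cong_cancel l : word_cong rels [:: l; inv_letter l] [::]
| word_cong_rel r : r \in rels -> word_cong rels r.1 r.2.

Section FpGroup.
Variables (n : nat) (rels : seq (word n * word n)).

Definition word_congb (u v : word n) : bool := `[< word_cong rels u v >].

Lemma word_congb_equiv : equiv_class_of word_congb.
Proof.
split=> [u|u v|v u w].
- exact/asboolP/word_cong_refl.
- by apply/asboolP/asboolP; apply: word_cong_sym.
- move=> /asboolP uv /asboolP vw; apply/asboolP; exact: word_cong_trans uv vw.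
Qed.

Canonical word_cong_equiv := EquivRelPack word_congb_equiv.

Definition fpgroup : Type := {eq_quot word_cong_equiv}%qT.
HB.instance Definition _ := Choice.on fpgroup.

Definition fp_class (u : word n) : fpgroup :=
  (\pi_({eq_quot word_cong_equiv}) u)%qT.
Definition fp_repr (x : fpgroup) : word n :=
  repr (x : {eq_quot word_cong_equiv}%qT).

Lemma fp_reprK (x : fpgroup) : fp_class (fp_repr x) = x.
Proof. exact: reprK. Qed.

Lemma fp_classP (u v : word n) : fp_class u = fp_class v <-> word_cong rels u v.
Proof. by split=> [/eqmodP/asboolP//|uv]; apply/eqmodP/asboolP. Qed.

Lemma fp_repr_cong (u : word n) : word_cong rels (fp_repr (fp_class u)) u.
Proof. by apply/fp_classP; rewrite fp_reprK. Qed.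

Lemma fp_classW (P : fpgroup -> Prop) : (forall u, P (fp_class u)) -> forall x, P x.
Proof. by move=> h x; rewrite -(fp_reprK x). Qed.

Lemma inv_letterK : involutive (@inv_letter n).
Proof. by case=> i e; rewrite /inv_letter /= negbK. Qed.

Lemma inv_word_cat (u v : word n) : inv_word (u ++ v) = inv_word v ++ inv_word u.
Proof. by rewrite /inv_word map_cat rev_cat. Qed.

Lemma inv_wordK : involutive (@inv_word n).
Proof.
move=> u; rewrite /inv_word map_rev revK -map_comp -[RHS]map_id.
by apply: eq_map => l /=; rewrite inv_letterK.
Qed.

Lemma cong_mulV (u : word n) : word_cong rels (u ++ inv_word u) [::].
Proof.
elim: u => [|l u IH]; first exact: word_cong_refl.
rewrite -[l :: u]/([:: l] ++ u) inv_word_cat -catA [u ++ _]catA.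
apply: word_cong_trans (word_cong_cancel rels l).
rewrite -[[:: l; _]]/([:: l] ++ ([::] ++ inv_word [:: l])).
apply: word_cong_cat (word_cong_refl _ _) _.
exact: word_cong_cat IH (word_cong_refl _ _).
Qed.

Lemma cong_inv (u v : word n) :
  word_cong rels u v -> word_cong rels (inv_word u) (inv_word v).
Proof.
move=> uv.
have vu : word_cong rels (v ++ inv_word u) [::].
  apply: word_cong_trans (cong_mulV u).
  exact: word_cong_cat (word_cong_sym uv) (word_cong_refl _ _).
have h1 : word_cong rels (inv_word v ++ (v ++ inv_word u)) (inv_word v).
  rewrite -[X in word_cong _ _ X]cats0.
  exact: word_cong_cat (word_cong_refl _ _) vu.
apply: word_cong_trans h1; apply: word_cong_sym; rewrite catA.
rewrite -[X in word_cong _ _ X]cat0s.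
apply: word_cong_cat (word_cong_refl _ _).
by have := cong_mulV (inv_word v); rewrite inv_wordK.
Qed.

Definition fp_one : fpgroup := fp_class [::].
Definition fp_mul (x y : fpgroup) : fpgroup := fp_class (fp_repr x ++ fp_repr y).
Definition fp_inv (x : fpgroup) : fpgroup := fp_class (inv_word (fp_repr x)).

Lemma fp_mulE (u v : word n) :
  fp_mul (fp_class u) (fp_class v) = fp_class (u ++ v).
Proof. by apply/fp_classP; apply: word_cong_cat; apply: fp_repr_cong. Qed.

Lemma fp_invE (u : word n) : fp_inv (fp_class u) = fp_class (inv_word u).
Proof. by apply/fp_classP/cong_inv/fp_repr_cong. Qed.

Lemma fp_mulA : associative fp_mul.
Proof. by elim/fp_classW=> u; elim/fp_classW=> v; elim/fp_classW=> w; rewrite !fp_mulE catA. Qed.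

Lemma fp_mul1 : left_id fp_one fp_mul.
Proof. by elim/fp_classW=> u; rewrite fp_mulE. Qed.

Lemma fp_mulr1 : right_id fp_one fp_mul.
Proof. by elim/fp_classW=> u; rewrite fp_mulE cats0. Qed.

Lemma fp_mulV : left_inverse fp_one fp_inv fp_mul.
Proof.
elim/fp_classW=> u; rewrite fp_invE fp_mulE; apply/fp_classP.
by have := cong_mulV (inv_word u); rewrite inv_wordK.
Qed.

Lemma fp_mulrV : right_inverse fp_one fp_inv fp_mul.
Proof. by elim/fp_classW=> u; rewrite fp_invE fp_mulE; apply/fp_classP/cong_mulV. Qed.

HB.instance Definition _ :=
  isGroup.Build fpgroup fp_mulA fp_mul1 fp_mulr1 fp_mulV fp_mulrV.

Definition fpgen (i : 'I_n) : fpgroup := fp_class [:: (i, false)].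

End FpGroup.

(* G_pt = < a, b ; a^p = b^t >, with a and b the generators 0 and 1. *)
Definition Gpt_rels (p t : nat) : seq (word 2 * word 2) :=
  [:: (nseq p (ord0, false), nseq t (ord_max, false))].
Definition Gpt (p t : nat) := fpgroup (Gpt_rels p t).
Definition Gpt_gen (p t : nat) : 'I_2 -> Gpt p t := @fpgen 2 (Gpt_rels p t).
HB.instance Definition _ p t := Group.on (Gpt p t).

Section Representations.
Variable K : fieldType.

(* Homomorphisms G -> SL_2(K), as maps into the 2 x 2 matrices. *)
Definition is_SL2_hom (G : groupType) (rho : G -> 'M[K]_2) : Prop :=
  (forall g, \det (rho g) = 1) /\
  (forall g h, rho (g * h)%g = rho g *m rho h).

(* The point of affine 4n-space whose coordinates are the entries of the
   matrices m_0, ..., m_(n-1). *)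
Definition mx_coords n (m : 'I_n -> 'M[K]_2) : 'rV[K]_(n * (2 * 2)) :=
  mxvec (\matrix_(i < n) mxvec (m i)).

(* R(G), relative to the generating tuple x. *)
Definition repr_variety (G : groupType) n (x : 'I_n -> G) :
    set 'rV[K]_(n * (2 * 2)) :=
  [set v | exists2 rho : G -> 'M[K]_2,
             is_SL2_hom rho & v = mx_coords (fun i => rho (x i))].

Definition eval_letter n (m : 'I_n -> 'M[K]_2) (l : 'I_n * bool) : 'M[K]_2 :=
  if l.2 then invmx (m l.1) else m l.1.
Definition eval_word n (m : 'I_n -> 'M[K]_2) (w : word n) : 'M[K]_2 :=
  foldr (fun l A => eval_letter m l *m A) 1%:M w.

Lemma eval_word_cat n (m : 'I_n -> 'M[K]_2) u v :
  eval_word m (u ++ v) = eval_word m u *m eval_word m v.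
Proof. by elim: u => [|l u IH] /=; rewrite ?mul1mx // IH mulmxA. Qed.

Lemma det_eval_word n (m : 'I_n -> 'M[K]_2) w :
  (forall i, \det (m i) = 1) -> \det (eval_word m w) = 1.
Proof.
move=> h; elim: w => [|l w IH] /=; first by rewrite det1.
by rewrite det_mulmx IH mulr1 /eval_letter; case: l.2; rewrite ?det_inv h ?invr1.
Qed.

Lemma eval_word_cong n (rels : seq (word n * word n)) (m : 'I_n -> 'M[K]_2) :
  (forall i, \det (m i) = 1) ->
  (forall r, r \in rels -> eval_word m r.1 = eval_word m r.2) ->
  forall u v, word_cong rels u v -> eval_word m u = eval_word m v.
Proof.
move=> h hr u v; elim=> //= {u v} [u v w _ -> _ -> //|u u' v v' _ e1 _ e2|[i e]].
  by rewrite !eval_word_cat e1 e2.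
have mU : m i \in unitmx by rewrite unitmxE h unitr1.
by rewrite mulmx1 /eval_letter; case: e; rewrite /= ?mulVmx ?mulmxV.
Qed.

Lemma SL2_hom1 (G : groupType) (rho : G -> 'M[K]_2) :
  is_SL2_hom rho -> rho 1%g = 1%:M.
Proof.
move=> [hd hm]; have U : rho 1%g \in unitmx by rewrite unitmxE hd unitr1.
by rewrite -[LHS](mulKmx U) -hm mulg1 mulVmx.
Qed.

Lemma SL2_hom_fp_class n (rels : seq (word n * word n))
    (rho : fpgroup rels -> 'M[K]_2) :
  is_SL2_hom rho ->
  forall w, rho (fp_class rels w) = eval_word (fun i => rho (fpgen rels i)) w.
Proof.
move=> hrho; have [hd hm] := hrho.
have cE u v : fp_class rels (u ++ v) = (fp_class rels u * fp_class rels v)%g.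
  by rewrite -fp_mulE.
elim=> [|[i e] w IH] /=; first exact: (SL2_hom1 hrho).
rewrite -[(i, e) :: w]/([:: (i, e)] ++ w) cE hm IH; congr (_ *m _).
rewrite /eval_letter; case: e => //=.
have U : rho (fpgen rels i) \in unitmx by rewrite unitmxE hd unitr1.
rewrite -[LHS](mulKmx U) -hm -cE.
have -> : fp_class rels ([:: (i, false)] ++ [:: (i, true)]) = 1%g.
  by apply/fp_classP; exact: (word_cong_cancel rels (i, false)).
by rewrite (SL2_hom1 hrho) mulmx1.
Qed.

Lemma repr_variety_fpgroup n (rels : seq (word n * word n)) :
  repr_variety (fpgen rels) =
  [set v | exists m : 'I_n -> 'M[K]_2,
     [/\ forall i, \det (m i) = 1,
         forall r, r \in rels -> eval_word m r.1 = eval_word m r.2 &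
         v = mx_coords m]].
Proof.
apply/seteqP; split=> v /=.
  move=> [rho hrho ->]; exists (fun i => rho (fpgen rels i)); split=> //.
    by move=> i; case: hrho.
  move=> r rr; rewrite -!SL2_hom_fp_class //; congr rho.
  by apply/fp_classP; exact: word_cong_rel.
move=> [m [hd hr ->]]; exists (fun x => eval_word m (fp_repr x)).
  split=> [g|g h]; first exact: det_eval_word.
  rewrite -eval_word_cat; apply: (eval_word_cong hd hr).
  exact: (fp_repr_cong rels (fp_repr g ++ fp_repr h)).
congr mx_coords; apply/funext => i.
rewrite (eval_word_cong hd hr (fp_repr_cong rels _)) /=.
by rewrite /eval_letter /= mulmx1.
Qed.

Lemma repr_variety_Gpt (p t : nat) :
  repr_variety (@Gpt_gen p t) =
  [set v | exists m : 'I_2 -> 'M[K]_2,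
     [/\ \det (m ord0) = 1, \det (m ord_max) = 1,
         m ord0 ^+ p = m ord_max ^+ t & v = mx_coords m]].
Proof.
have ev (m : 'I_2 -> 'M[K]_2) k i : eval_word m (nseq k (i, false)) = m i ^+ k.
  by elim: k => [|k IH] //=; rewrite IH exprS.
rewrite [LHS]repr_variety_fpgroup; apply/seteqP; split=> v [m] /=.
  move=> [hd hr ->]; exists m; split=> //.
  by rewrite -!ev; apply: (hr (_, _)); rewrite mem_seq1.
move=> [h0 h1 hm ->]; exists m; split=> // [i|r].
  case: (unliftP ord0 i) => [j ->|-> //].
  by rewrite (_ : lift ord0 j = ord_max) //; apply/val_inj; rewrite /= (ord1 j).
by rewrite mem_seq1 => /eqP -> /=; rewrite !ev.
Qed.

End Representations.

Arguments repr_variety K {G n} x.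

Section Zariski.
Variables (K : fieldType) (N : nat).
Implicit Types V : set 'rV[K]_N.

Definition zariski_closed V : Prop :=
  exists S : set {mpoly K[N]},
    V = [set v | forall f, S f -> f.@[v ord0] = 0].

Definition zariski_irreducible V : Prop :=
  V !=set0 /\
  forall A B : set 'rV[K]_N, zariski_closed A -> zariski_closed B ->
    V `<=` A `|` B -> V `<=` A \/ V `<=` B.

Definition irreducible_closed_in V (Z : set 'rV[K]_N) : Prop :=
  [/\ Z `<=` V, zariski_closed Z & zariski_irreducible Z].

Definition irreducible_component V (Z : set 'rV[K]_N) : Prop :=
  irreducible_closed_in V Z /\
  forall Z', irreducible_closed_in V Z' -> Z `<=` Z' -> Z' = Z.

Definition irreducible_chain V (d : nat) (Z : nat -> set 'rV[K]_N) : Prop :=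
  (forall i, (i <= d)%N -> irreducible_closed_in V (Z i)) /\
  (forall i, (i < d)%N -> Z i `<` Z i.+1).

(* Krull dimension. *)
Definition zariski_dim V (d : nat) : Prop :=
  (exists Z, irreducible_chain V d Z) /\
  (forall e Z, irreducible_chain V e Z -> (e <= d)%N).

Definition components_of_dim V (d : nat) : set (set 'rV[K]_N) :=
  [set Z | irreducible_component V Z /\ zariski_dim Z d].

End Zariski.

(* Main.v *)
Require Import Defs.
From mathcomp Require Import all_boot all_order all_algebra all_solvable all_field.
From mathcomp Require Import boolp classical_sets functions cardinality reals.
From mathcomp Require Import complex mpoly ring zify.

(** Write V for the variety of pairs (A, B) in SL_2 with A^p = B^t.

    By Cayley-Hamilton A^p is a combination c A + e of A and the identity.
    Since A^p = B^t commutes with B, a pair that does not commute has c = 0,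
    so A^p is scalar; then the eigenvalues l, 1/l of A are distinct and
    l^p = l^-p.  With z a primitive 2p-th root of unity this forces
    tr A = z^k + z^-k with 0 < k < p, and then A^p = (-1)^k; likewise
    tr B = z'^k' + z'^-k' and B^t = (-1)^k', so that k and k' have the same
    parity ([noncommuting_traces]).  Conversely all pairs with such traces lie
    in V ([trace_component_sub]).  Hence V is the union of the finitely many
    sets [trace_component z z' k k'] and of its commuting pairs
    ([variety_cover]).

    Each trace component is a product of two conjugacy classes.  A class is
    the image of (x, y, w) under a polynomial map, namely the conjugates of the
    matrices (l w; 0 1/l) by products of elementary matrices, so the product is
    irreducible; the chain
      point < line < line x line < class x line < class x class
    and the charts with y = 0 or y = 1 show that its dimension is 4
    ([stratum_pair_dim]).  Commuting pairs are simultaneously triangularizable,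
    and picking s with l = s^t turns l^p = m^t into m = (root of unity) * s^p:
    they are covered by finitely many rational images of 3-space
    ([commuting_pairs_dim_le]).  A 4-dimensional component therefore lies in a
    trace component, and these are pairwise not included in each other because
    their traces differ, nor in the set of commuting pairs.  Counting the pairs
    (k, k') of equal parity gives
      C_4 = floor(p/2) floor(t/2) + floor((p-1)/2) floor((t-1)/2).

    The dimension bounds rest on two elementary facts.  A strict inclusion of
    irreducible closed sets lets one add a polynomial to an algebraically
    independent family ([alg_indep_proper]), so a chain of length e yields e
    independent polynomials on its last set.  On the other hand d + 1
    polynomials pulled back to d-space along a rational map are algebraically
    dependent, as there are more monomials in them than the space of
    polynomials of the relevant degree has dimensions
    ([alg_dim_le_chart]). *)

Set Implicit Arguments.
Unset Strict Implicit.
Unset Printing Implicit Defensive.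

Import GRing.Theory.
Local Open Scope ring_scope.

(** * Regular functions *)

Section PolynomialFunctions.
Variables (K : fieldType) (d : nat).
Implicit Types (f g : 'rV[K]_d -> K) (H : {mpoly K[d]}).

(** The functions q / H^n off the zero locus of H.  The class with H = 1
    consists of the polynomial functions and serves for closed sets; a
    nonconstant H is needed for charts that involve inverses. *)
Definition regular_on H f : Prop :=
  exists n (q : {mpoly K[d]}),
    forall v : 'rV[K]_d, H.@[v ord0] != 0 -> f v * H.@[v ord0] ^+ n = q.@[v ord0].

Lemma regular_mpoly H (q : {mpoly K[d]}) :
  regular_on H (fun v => q.@[v ord0]).
Proof. by exists 0%N, q => v _; rewrite expr0 mulr1. Qed.

Lemma regular_const H c : regular_on H (fun=> c).
Proof. by exists 0%N, c%:MP => v _; rewrite expr0 mulr1 mevalC. Qed.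

Lemma regular_coord H i : regular_on H (fun v => v ord0 i).
Proof. by exists 0%N, 'X_i => v _; rewrite expr0 mulr1 mevalXU. Qed.

Lemma regularD H f g :
  regular_on H f -> regular_on H g -> regular_on H (fun v => f v + g v).
Proof.
move=> [n [q hq]] [m [r hr]]; exists (n + m)%N, (q * H ^+ m + r * H ^+ n) => v hv.
by rewrite mevalD !mevalM !rmorphXn /= -hq // -hr // exprD; ring.
Qed.

Lemma regularM H f g :
  regular_on H f -> regular_on H g -> regular_on H (fun v => f v * g v).
Proof.
move=> [n [q hq]] [m [r hr]]; exists (n + m)%N, (q * r) => v hv.
by rewrite mevalM -hq // -hr // exprD; ring.
Qed.

Lemma regularN H f : regular_on H f -> regular_on H (fun v => - f v).
Proof.
by move=> [n [q hq]]; exists n, (- q) => v hv; rewrite mevalN -hq // mulNr.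
Qed.

Lemma regularX H f n : regular_on H f -> regular_on H (fun v => f v ^+ n).
Proof.
move=> hf; elim: n => [|n IH]; first exact: regular_const.
by under eq_fun do rewrite exprS; apply: regularM.
Qed.

Lemma regularV H : regular_on H (fun v => (H.@[v ord0])^-1).
Proof. by exists 1%N, 1 => v hv; rewrite expr1 mulVf // meval1. Qed.

Lemma regular_sum H (I : Type) (s : seq I) (F : I -> 'rV[K]_d -> K) :
  (forall i, regular_on H (F i)) -> regular_on H (fun v => \sum_(i <- s) F i v).
Proof.
move=> hF; elim: s => [|i s IH].
  by under eq_fun do rewrite big_nil; apply: regular_const.
by under eq_fun do rewrite big_cons; apply: regularD.
Qed.

Lemma regular_prod H (I : Type) (s : seq I) (F : I -> 'rV[K]_d -> K) :
  (forall i, regular_on H (F i)) -> regular_on H (fun v => \prod_(i <- s) F i v).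
Proof.
move=> hF; elim: s => [|i s IH].
  by under eq_fun do rewrite big_nil; apply: regular_const.
by under eq_fun do rewrite big_cons; apply: regularM.
Qed.

Lemma regular_comp H N (phi : 'rV[K]_d -> 'rV[K]_N) (q : {mpoly K[N]}) :
  (forall i, regular_on H (fun v => phi v ord0 i)) ->
  regular_on H (fun v => q.@[phi v ord0]).
Proof.
move=> hphi; under eq_fun do rewrite mevalE.
apply: regular_sum => m; apply: regularM; first exact: regular_const.
by apply: regular_prod => i; apply: regularX.
Qed.

Lemma regular1P f :
  regular_on 1 f -> exists q : {mpoly K[d]}, forall v : 'rV[K]_d, f v = q.@[v ord0].
Proof.
by move=> [n [q hq]]; exists q => v; rewrite -hq meval1 ?oner_eq0 // expr1n mulr1.
Qed.

End PolynomialFunctions.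

(** * Closed and irreducible sets *)

Section ZariskiClosed.
Variables (K : fieldType) (N : nat).
Implicit Types A B Z : set 'rV[K]_N.
Local Open Scope classical_set_scope.

Lemma zariski_closed0 : zariski_closed (set0 : set 'rV[K]_N).
Proof.
exists [set 1]; apply/seteqP; split=> // v /= /(_ _ erefl).
by rewrite meval1 => /eqP; rewrite oner_eq0.
Qed.

Lemma zariski_closed_eq (f g : 'rV[K]_N -> K) :
  regular_on 1 f -> regular_on 1 g -> zariski_closed [set v | f v = g v].
Proof.
move=> /regular1P[q hq] /regular1P[r hr]; exists [set q - r].
apply/seteqP; split=> v /=.
  by rewrite hq hr => e _ ->; rewrite mevalB e subrr.
by move=> /(_ _ erefl); rewrite mevalB hq hr => /eqP; rewrite subr_eq0 => /eqP.
Qed.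

Lemma zariski_closedI A B :
  zariski_closed A -> zariski_closed B -> zariski_closed (A `&` B).
Proof.
move=> [S ->] [T ->]; exists (S `|` T); apply/seteqP; split=> v /=.
  by move=> [hS hT] f []; [exact: hS|exact: hT].
by move=> h; split=> f hf; apply: h; [left|right].
Qed.

Lemma zariski_closedU A B :
  zariski_closed A -> zariski_closed B -> zariski_closed (A `|` B).
Proof.
move=> [S ->] [T ->].
exists [set h | exists2 f, S f & exists2 g, T g & h = f * g].
apply/seteqP; split=> v /=.
  by move=> [h|h] f0 [f Sf [g Tg ->]]; rewrite mevalM;
    [rewrite (h f Sf) mul0r|rewrite (h g Tg) mulr0].
move=> h; case: (pselect (forall f, S f -> f.@[v ord0] = 0)) => [|nS]; first by left.
right=> g Tg; move/existsNP: nS => [f /not_implyP[Sf /eqP fv]].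
have /eqP := h _ (ex_intro2 _ _ f Sf (ex_intro2 _ _ g Tg erefl)).
by rewrite mevalM mulf_eq0 (negPf fv) => /eqP.
Qed.

Lemma bigcup_enum (I : finType) (F : I -> set 'rV[K]_N) :
  \bigcup_i F i = \big[setU/set0]_(i <- enum I) F i.
Proof.
rewrite -bigcup_seq; apply/seteqP; split=> v [i _ hi]; exists i => //=.
by rewrite mem_enum.
Qed.

Lemma irreducible_sub_bigcup (I : finType) (F : I -> set 'rV[K]_N) A Z :
  zariski_irreducible Z -> zariski_closed A ->
  (forall i, zariski_closed (F i)) ->
  Z `<=` A `|` \bigcup_i F i -> Z `<=` A \/ exists i, Z `<=` F i.
Proof.
move=> [_ irrZ] cA cF.
rewrite bigcup_enum.
have cbig s : zariski_closed (\big[setU/set0]_(i <- s) F i).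
  elim: s => [|i s IH]; first by rewrite big_nil; exact: zariski_closed0.
  by rewrite big_cons; apply: zariski_closedU.
elim: (enum I) => [|i s IH]; first by rewrite big_nil setU0; left.
rewrite big_cons setUCA => /(irrZ _ _ (cF i) (zariski_closedU cA (cbig s))).
by case=> [|/IH //]; right; exists i.
Qed.

End ZariskiClosed.

Section Irreducibility.
Variables (K : fieldType) (K0 : [pchar K] =i pred0).
Local Open Scope classical_set_scope.

(** Two points of the image of an affine space are joined by the image of a
    line.  If one is outside A and the other outside B, the restrictions to that
    line of suitable equations of A and B are nonzero polynomials in one
    variable, whose product cannot vanish at all points, the field being infinite. *)
Lemma irreducible_image m N (phi : 'rV[K]_m -> 'rV[K]_N) :
  (forall i, regular_on 1 (fun v => phi v ord0 i)) ->
  zariski_irreducible (range phi).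
Proof.
move=> hphi; split; first by exists (phi 0), 0.
move=> A B [S ->] [T ->] hAB.
apply: contrapT => /not_orP[/existsNP[_ /not_implyP[[u _ <-]]] +
                            /existsNP[_ /not_implyP[[v _ <-]]]].
move=> /existsNP[f /not_implyP[Sf fu]] /existsNP[g /not_implyP[Tg gv]].
have line (h : {mpoly K[N]}) : exists q : {poly K},
    forall s, q.[s] = h.@[phi (u + s *: (v - u)) ord0].
  have /regular1P[q hq] := regular_comp h hphi.
  exists (mmap polyC (fun i => (u ord0 i)%:P + 'X * (v ord0 i - u ord0 i)%:P) q).
  move=> s; rewrite hq mevalE /mmap horner_sum; apply: eq_bigr => k _.
  rewrite hornerM hornerC /mmap1 horner_prod; congr (_ * _).
  by apply: eq_bigr => i _; rewrite horner_exp !hornerE !mxE.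
have [q hq] := line f; have [r hr] := line g.
have q0 : q != 0.
  by apply/negP => /eqP e; apply: fu; have := hq 0; rewrite e horner0 scale0r addr0.
have r0 : r != 0.
  apply/negP => /eqP e; apply: gv; have := hr 1.
  by rewrite e horner0 scale1r addrC subrK.
have qr0 : q * r != 0 by rewrite mulf_neq0.
(* a product vanishing at every natural number has too many roots *)
pose s : seq K := [seq k%:R | k <- iota 0 (size (q * r))].
have : (size s < size (q * r)%R)%N; last by rewrite size_map size_iota ltnn.
apply: max_poly_roots => //.
  apply/allP => c _; rewrite rootE hornerM hq hr; apply/eqP.
  by case: (hAB (phi (u + c *: (v - u)))) => [|/(_ f Sf) ->|/(_ g Tg) ->];
    [exists (u + c *: (v - u))|rewrite mul0r|rewrite mulr0].
rewrite map_inj_uniq ?iota_uniq // => a b.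
wlog ab : a b / (a <= b)%N.
  by move=> W; case: (leqP a b) => [|/ltnW] /W // h e; apply/esym/h.
move=> /eqP; rewrite eq_sym -subr_eq0 -natrB // (iffLR (pcharf0P K) K0) subn_eq0 => ba.
by apply/eqP; rewrite eqn_leq ab.
Qed.

End Irreducibility.

(** * Bounds on the length of chains *)

Section DimensionBounds.
Variables (K : fieldType) (N : nat).
Implicit Types Z S : set 'rV[K]_N.
Local Open Scope classical_set_scope.

Definition alg_indep_on Z k (f : k.-tuple {mpoly K[N]}) : Prop :=
  forall P : {mpoly K[k]}, (forall v, Z v -> (P \mPo f).@[v ord0] = 0) -> P = 0.

(** For a set that need not be irreducible, this says that no irreducible
    component of its closure has a coordinate ring of transcendence degree above d. *)
Definition alg_dim_le d Z : Prop :=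
  forall f : d.+1.-tuple {mpoly K[N]}, ~ alg_indep_on Z f.

Lemma muni_eq0 k (P : {mpoly K[k.+1]}) : muni P = 0 -> P = 0.
Proof.
move=> P0; apply/mpolyP => m; rewrite mcoeff0.
pose r (m' : 'X_{1..k.+1}) : 'X_{1..k} :=
  [multinom m' (widen_ord (leqnSn k) i) | i < k].
have := congr1 (fun p : {poly {mpoly K[k]}} => (p`_(m ord_max))@_(r m)) P0.
rewrite coef0 mcoeff0 => <-; rewrite muniE coef_sum raddf_sum /=.
rewrite [in LHS](mpolyE P) raddf_sum /=; apply: eq_bigr => m' _.
rewrite coefZ coefXn -scalerAl !mcoeffZ mcoeffX; congr (_ * _).
case: (eqVneq (m ord_max) (m' ord_max)) => [e|ne]; last first.
  by rewrite mulr0 mcoeff0; case: eqP => // e; rewrite e eqxx in ne.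
rewrite mulr1 mcoeffX; congr (nat_of_bool _)%:R.
apply/eqP/eqP => [-> //|er]; apply/mnmP => i.
case: (unliftP ord_max i) => [j ->|-> //].
have -> : lift ord_max j = widen_ord (leqnSn k) j.
  by apply: val_inj; rewrite /= /bump leqNgt ltn_ord.
by move/mnmP/(_ j): er; rewrite !mnmE.
Qed.

Lemma comp_mpoly_rcons k (P : {mpoly K[k.+1]}) (f : k.-tuple {mpoly K[N]}) g :
  P \mPo [tuple of rcons f g] = (map_poly (comp_mpoly f) (muni P)).[g].
Proof.
rewrite muniE rmorph_sum horner_sum comp_mpolyE; apply: eq_bigr => m _.
rewrite -mul_polyC rmorphM /= map_polyC /= map_polyXn hornerM hornerC hornerXn.
rewrite linearZ /= comp_mpolyX -scalerAl; congr (_ *: _).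
rewrite big_ord_recr /=; congr (_ * _); last first.
  by rewrite (tnth_nth 0) /= nth_rcons size_tuple ltnn eqxx.
apply: eq_bigr => i _; rewrite mnmE !(tnth_nth 0) /= nth_rcons size_tuple.
by rewrite ltn_ord.
Qed.

Lemma irreducible_prime Z (f g : {mpoly K[N]}) :
  zariski_irreducible Z -> (forall v, Z v -> (f * g).@[v ord0] = 0) ->
  (forall v, Z v -> f.@[v ord0] = 0) \/ (forall v, Z v -> g.@[v ord0] = 0).
Proof.
have closed0 (h : {mpoly K[N]}) :
    zariski_closed [set v : 'rV[K]_N | h.@[v ord0] = 0].
  by apply: zariski_closed_eq; [exact: regular_mpoly|exact: regular_const].
move=> [_ irrZ] fg; apply: irrZ (closed0 f) (closed0 g) _ => v /fg /eqP.
by rewrite mevalM mulf_eq0 => /orP[] /eqP; [left|right].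
Qed.

(** Take g vanishing on Z but not on Z'.  In a relation P (f, g) = 0 on Z' one
    can cancel the powers of g, since Z' is irreducible; then P (x, 0) is nonzero
    and gives a relation between the f on Z. *)
Lemma alg_indep_proper Z Z' k (f : k.-tuple {mpoly K[N]}) :
  zariski_closed Z -> zariski_irreducible Z' -> Z `<` Z' ->
  alg_indep_on Z f -> exists g, alg_indep_on Z' [tuple of rcons f g].
Proof.
move=> [S ZS] irrZ' [ZZ' /existsNP[u /not_implyP[Z'u]]].
rewrite {1}ZS => /existsNP[g /not_implyP[Sg /eqP gu]] indep.
exists g => P vanP; apply: muni_eq0; apply/eqP; apply: contraT => P0.
(* factor out the largest power of the last variable *)
have [n [q q0 Pq]] := multiplicity_XsubC (muni P) 0.
rewrite P0 /= in q0; rewrite polyC0 subr0 in Pq.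
case/eqP: q0; rewrite horner_coef0; apply: indep => v Zv.
have -> : (q`_0 \mPo f).@[v ord0] = (map_poly (comp_mpoly f) q).[g].@[v ord0].
  rewrite -(horner_map (meval (v ord0))) /=.
  have -> : g.@[v ord0] = 0 by move: Zv; rewrite ZS; apply.
  by rewrite horner_coef0 !coef_map.
have vanQ w : Z' w -> ((map_poly (comp_mpoly f) q).[g] * g ^+ n).@[w ord0] = 0.
  move=> /vanP <-; rewrite comp_mpoly_rcons Pq [map_poly _ (_ * _)]rmorphM /=.
  by rewrite map_polyXn hornerM hornerXn.
case: (irreducible_prime irrZ' vanQ) => [|/(_ u Z'u)]; first by apply; exact: ZZ'.
by rewrite rmorphXn /= => /eqP; rewrite expf_eq0 (negPf gu) andbF.
Qed.

(** Start with the empty family on the nonempty bottom set, and add one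
    polynomial per step. *)
Lemma irreducible_chain_indep V e (C : nat -> set 'rV[K]_N) :
  irreducible_chain V e C ->
  exists f : e.-tuple {mpoly K[N]}, alg_indep_on (C e) f.
Proof.
elim: e => [|e IH] [irrC ltC].
  exists [tuple] => P vanP; have [_ _ [[v Cv] _]] := irrC 0%N (leqnn _).
  have P_const : P = (P@_0)%:MP.
    apply: msize1_polyC; rewrite msizeE; apply/bigmax_leqP_seq => m _ _.
    by rewrite mdegE big_ord0.
  by have := vanP v Cv; rewrite P_const comp_mpolyC mevalC => ->; rewrite mpolyC0.
have [|f indf] := IH; first by split=> i ie; [apply: irrC|apply: ltC]; lia.
have [_ clC _] := irrC e (leqnSn e); have [_ _ irr'] := irrC e.+1 (leqnn _).
by have [g] := alg_indep_proper clC irr' (ltC e (ltnSn e)) indf;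
  exists [tuple of rcons f g].
Qed.

Lemma chain_length_le d S V e C :
  alg_dim_le d S -> irreducible_chain V e C -> C e `<=` S -> (e <= d)%N.
Proof.
move=> dimS chainC CS; rewrite leqNgt; apply/negP => de.
have [f indf] : exists f : d.+1.-tuple {mpoly K[N]}, alg_indep_on (C d.+1) f.
  apply: (irreducible_chain_indep (V := V)); case: chainC => irrC ltC.
  by split=> i ie; [apply: irrC|apply: ltC]; lia.
apply: (dimS f) => P vanP; apply: indf => v Cv; apply: vanP; apply: CS.
have mono k : (d.+1 + k <= e)%N -> C d.+1 `<=` C (d.+1 + k)%N.
  elim: k => [|k IH] ke; first by rewrite addn0.
  apply: subset_trans (IH _) _; first by lia.
  by rewrite addnS; case: (chainC.2 (d.+1 + k)%N); first by lia.
by have := mono (e - d.+1)%N; rewrite subnKC //; apply.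
Qed.

Lemma alg_dim_leS d S T : S `<=` T -> alg_dim_le d T -> alg_dim_le d S.
Proof.
by move=> ST dimT f indf; apply: (dimT f) => P vanP; apply: indf => v /ST /vanP.
Qed.

(** The product of relations valid on the pieces is a relation on the union. *)
Lemma alg_dim_le_bigcup d (I : finType) (F : I -> set 'rV[K]_N) :
  (forall i, alg_dim_le d (F i)) -> alg_dim_le d (\bigcup_i F i).
Proof.
move=> dimF f indf.
have [P hP] : {P : I -> {mpoly K[d.+1]} & forall i,
    P i != 0 /\ forall v, F i v -> (P i \mPo f).@[v ord0] = 0}.
  apply: (@choice _ _ (fun i P => P != 0 /\
    forall v, F i v -> (P \mPo f).@[v ord0] = 0)) => i.
  have := dimF i f; move=> /existsNP[P /not_implyP[vanP /eqP P0]].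
  by exists P.
have /eqP : \prod_i P i = 0.
  apply: indf => v [i _ Fv]; rewrite (bigD1 i) //= rmorphM /= mevalM.
  by rewrite (hP i).2 // mul0r.
by apply/negP/prodf_neq0 => i _; have [] := hP i.
Qed.

End DimensionBounds.

Section Charts.
Variables (K : fieldType) (d : nat).

Lemma msizeM_leS (p q : {mpoly K[d]}) a b :
  (msize p <= a.+1)%N -> (msize q <= b.+1)%N -> (msize (p * q) <= (a + b).+1)%N.
Proof.
move=> pa qb; have [->|p0] := eqVneq p 0; first by rewrite mul0r msize0.
have [->|q0] := eqVneq q 0; first by rewrite mulr0 msize0.
by rewrite msizeM // -subn1 leq_subLR add1n -addSn -addnS leq_add.
Qed.

Lemma msize_prod_le (I : Type) (s : seq I) (g : I -> {mpoly K[d]}) D :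
  (forall i, msize (g i) <= D.+1)%N ->
  (msize (\prod_(i <- s) g i)%R <= (size s * D).+1)%N.
Proof.
move=> hg; elim: s => [|i s IH]; first by rewrite big_nil msize1.
by rewrite big_cons mulSn; apply: msizeM_leS.
Qed.

Lemma exists_linear_relation (I J : finType) (M : I -> J -> K) :
  (#|J| < #|I|)%N ->
  exists2 c : I -> K, (exists i, c i != 0) & forall j, \sum_i c i * M i j = 0.
Proof.
move=> ltJI; pose A := \matrix_(i < #|I|, j < #|J|) M (enum_val i) (enum_val j).
have : kermx A != 0.
  by rewrite kermx_eq0 -row_leq_rank -ltnNge (leq_ltn_trans (rank_leq_col A)).
case/rowV0Pn=> c /sub_kermxP cA c0.
exists (fun i => c ord0 (enum_rank i)).
  have /rV0Pn[i ci] := c0; exists (enum_val i); by rewrite enum_valK.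
move=> j; have := congr1 (fun B : 'rV_#|J| => B ord0 (enum_rank j)) cA.
rewrite !mxE => e; apply: etrans e.
rewrite [RHS](reindex_onto enum_rank enum_val) /=; last first.
  by move=> i _; rewrite enum_valK.
by apply: eq_big => [i|i _]; rewrite ?mxE ?enum_rankK ?eqxx.
Qed.

(** The products below, indexed by n^(d+1) exponents, all have degree at most
    (d+1) n D, hence lie in a space of dimension ((d+1) n D + 1)^d, which is
    smaller for n large.  Completing the exponents with powers of h makes the
    relation homogeneous in the g i and h, so that it survives division by a power
    of h. *)
Lemma homogeneous_relation (g : 'I_d.+1 -> {mpoly K[d]}) (h : {mpoly K[d]}) :
  exists n (c : {ffun 'I_d.+1 -> 'I_n} -> K), (exists a, c a != 0) /\
    \sum_a c a *: (\prod_i (g i ^+ a i * h ^+ (n - a i))) = 0.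
Proof.
pose D := (msize h + \sum_i msize (g i))%N.
have hD : (msize h <= D.+1)%N by rewrite /D; lia.
have gD i : (msize (g i) <= D.+1)%N by rewrite /D (bigD1 i) //=; lia.
pose C := (d.+1 * D).+1; pose n := (C ^ d).+1.
pose B := (d.+1 * (n * D)).+1.
have ltB : (B ^ d < n ^ d.+1)%N.
  have leB : (B <= n * C)%N by rewrite /B /C /n; lia.
  apply: (@leq_ltn_trans ((n * C) ^ d)).
    by have [->//|d_gt0] := posnP d; rewrite leq_exp2r.
  by rewrite expnMn expnSr ltn_pmul2l ?expn_gt0.
pose G (a : {ffun 'I_d.+1 -> 'I_n}) := \prod_i (g i ^+ a i * h ^+ (n - a i)).
have sizeG a : (msize (G a) <= B)%N.
  rewrite /B -[d.+1 in leqRHS](card_ord d.+1) cardT enumT.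
  apply: msize_prod_le => i.
  have size_pow (q : {mpoly K[d]}) k : (msize q <= D.+1)%N ->
      (msize (q ^+ k) <= (k * D).+1)%N.
    move=> hq; rewrite -[k in q ^+ k](card_ord k) -prodr_const.
    by rewrite -[k in leqRHS](card_ord k) cardT enumT; apply: msize_prod_le.
  have -> : (n * D = a i * D + (n - a i) * D)%N.
    by rewrite -mulnDl subnKC // ltnW.
  by apply: msizeM_leS; apply: size_pow.
pose mon (b : {ffun 'I_d -> 'I_B}) : 'X_{1..d} := [multinom (b i : nat) | i < d].
have [|c c0 cG] := @exists_linear_relation _ _ (fun a b => (G a)@_(mon b)).
  by rewrite !card_ffun !card_ord.
exists n, c; split=> //; apply/mpolyP => m; rewrite mcoeff0 raddf_sum /=.
under eq_bigr do rewrite mcoeffZ.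
have [/forallP ltm|] := boolP [forall i, m i < B]%N.
  rewrite -[RHS](cG [ffun i => Ordinal (ltm i)]); apply: eq_bigr => a _.
  by congr (_ * _@__); apply/mnmP => i; rewrite mnmE ffunE.
rewrite negb_forall => /existsP; case=> i; rewrite -leqNgt => Bm.
apply: big1 => a _; rewrite memN_msupp_eq0 ?mulr0 //.
apply: msize_mdeg_ge; apply: leq_trans (sizeG a) (leq_trans Bm _).
by rewrite mdegE (bigD1 i) //= leq_addr.
Qed.

Local Open Scope classical_set_scope.

(** Multiplying the pulled back polynomials by a common power of H makes them
    polynomials in d variables; the homogeneous relation between them and that
    power is a relation between the original ones. *)
Lemma alg_dim_le_chart N (H : {mpoly K[d]}) (phi : 'rV[K]_d -> 'rV[K]_N) :
  (forall i, regular_on H (fun v => phi v ord0 i)) ->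
  alg_dim_le d (phi @` [set v : 'rV[K]_d | H.@[v ord0] != 0]).
Proof.
move=> regphi f indf.
pose F i (v : 'rV[K]_d) := (tnth f i).@[phi v ord0].
have [k hk] : {k : 'I_d.+1 -> nat & forall i, exists q : {mpoly K[d]},
    forall v : 'rV[K]_d, H.@[v ord0] != 0 ->
      F i v * H.@[v ord0] ^+ k i = q.@[v ord0]}.
  by apply: (@choice _ _ (fun i n => exists q : {mpoly K[d]}, forall v : 'rV[K]_d,
    H.@[v ord0] != 0 -> F i v * H.@[v ord0] ^+ n = q.@[v ord0])) => i;
    exact: regular_comp.
pose e := (\sum_i k i)%N.
have [g hg] : {g : 'I_d.+1 -> {mpoly K[d]} & forall i (v : 'rV[K]_d),
    H.@[v ord0] != 0 -> (g i).@[v ord0] = F i v * H.@[v ord0] ^+ e}.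
  apply: (@choice _ _ (fun i (q : {mpoly K[d]}) => forall v : 'rV[K]_d,
    H.@[v ord0] != 0 -> q.@[v ord0] = F i v * H.@[v ord0] ^+ e)) => i.
  have [q hq] := hk i; exists (q * H ^+ (e - k i)) => v Hv.
  rewrite mevalM rmorphXn /= -hq // -mulrA -exprD subnKC //.
  by rewrite /e (bigD1 i) //= leq_addr.
have [n [c [[a0 ca0] rel]]] := homogeneous_relation g (H ^+ e).
pose mon (a : {ffun 'I_d.+1 -> 'I_n}) : 'X_{1..d.+1} :=
  [multinom (a i : nat) | i < d.+1].
have mon_inj : injective mon.
  by move=> a b /mnmP ab; apply/ffunP => i; apply: val_inj; have := ab i; rewrite !mnmE.
have /(congr1 (mcoeff (mon a0))) : \sum_a c a *: 'X_[mon a] = 0.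
  apply: indf => _ [v Hv <-]; apply/eqP.
  have He0 : H.@[v ord0] ^+ e != 0 by rewrite expf_eq0 (negPf Hv) andbF.
  have : \sum_a c a * \prod_i (F i v ^+ a i) * H.@[v ord0] ^+ e ^+ n ^+ d.+1 = 0.
    have := congr1 (meval (v ord0)) rel; rewrite meval0 raddf_sum /= => e0.
    apply: etrans e0; apply: eq_bigr => a _; rewrite mevalZ rmorph_prod /= -mulrA; congr (_ * _).
    rewrite (_ : _ ^+ d.+1 = \prod_(i < d.+1) H.@[v ord0] ^+ e ^+ n);
      last by rewrite prodr_const card_ord.
    rewrite -big_split /=.
    apply: eq_bigr => i _; rewrite mevalM !rmorphXn /= hg // exprMn -mulrA.
    by rewrite -exprD subnKC // ltnW.
  rewrite -mulr_suml => /eqP; rewrite mulf_eq0 2?expf_eq0 (negPf He0) !andbF orbF.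
  rewrite (raddf_sum (comp_mpoly f)) (raddf_sum (meval _)) => /eqP e0.
  apply/eqP; apply: etrans e0; apply: eq_bigr => a _ /=.
  rewrite comp_mpolyZ mevalZ comp_mpoly_meval mevalX; congr (_ * _).
  by apply: eq_bigr => i _; rewrite mnmE.
rewrite mcoeff0 raddf_sum /= (bigD1 a0) //= mcoeffZ mcoeffX eqxx mulr1.
rewrite big1 ?addr0 => [e0|a aa0]; first by rewrite e0 eqxx in ca0.
by rewrite mcoeffZ mcoeffX (inj_eq mon_inj) (negPf aa0) mulr0.
Qed.

End Charts.

(** * Two by two matrices *)

Section TwoByTwo.
Variable K : fieldType.
Implicit Types (A B : 'M[K]_2) (a b c d x y l w k : K).

Definition mx2 a b c d : 'M[K]_2 :=
  \matrix_(i, j) if i == ord0 then (if j == ord0 then a else b)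
                 else (if j == ord0 then c else d).

Lemma mx2P A : exists a b c d, A = mx2 a b c d.
Proof.
exists (A ord0 ord0), (A ord0 ord_max), (A ord_max ord0), (A ord_max ord_max).
by apply/matrixP => -[[|[|//]] ?] [[|[|//]] ?]; rewrite mxE /=; congr (A _ _);
  apply: val_inj.
Qed.

Lemma mx2_inj a b c d a' b' c' d' :
  mx2 a b c d = mx2 a' b' c' d' -> [/\ a = a', b = b', c = c' & d = d'].
Proof.
by move/matrixP => e; move: (e ord0 ord0) (e ord0 ord_max) (e ord_max ord0)
  (e ord_max ord_max); rewrite !mxE.
Qed.

Lemma mul_mx2 a b c d a' b' c' d' : mx2 a b c d *m mx2 a' b' c' d' =
  mx2 (a * a' + b * c') (a * b' + b * d') (c * a' + d * c') (c * b' + d * d').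
Proof.
by apply/matrixP => i j; rewrite !mxE !big_ord_recl big_ord0 !mxE /= addr0;
  case: eqP => _; case: eqP => _.
Qed.

Lemma det_mx2 a b c d : \det (mx2 a b c d) = a * d - b * c.
Proof.
rewrite (expand_det_row _ ord0) !big_ord_recl big_ord0 /cofactor !det_mx11 !mxE /=.
by ring.
Qed.

Lemma tr_mx2 a b c d : \tr (mx2 a b c d) = a + d.
Proof. by rewrite /mxtrace !big_ord_recl big_ord0 !mxE addr0. Qed.

(** The upper triangular matrix (l w; 0 k) conjugated by
    (1 x; 0 1) (1 0; y 1).  The conjugating matrix sends the first basis vector to
    (1 + xy, y), so that y = 1 and y = x = 0 already reach all lines. *)
Definition conj_tri x y l w k : 'M[K]_2 :=
  mx2 1 x 0 1 *m mx2 1 0 y 1 *m mx2 l w 0 k *m mx2 1 0 (- y) 1 *m mx2 1 (- x) 0 1.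

Lemma conj_triE x y l w k (c := y * (l - k - y * w)) : conj_tri x y l w k =
  mx2 (l - w * y + x * c) (w + x * (k + y * w) - x * (l - w * y + x * c))
      c (k + y * w - x * c).
Proof. by rewrite /conj_tri !mul_mx2 /c; congr mx2; ring. Qed.

Lemma det_conj_tri x y l w k : \det (conj_tri x y l w k) = l * k.
Proof. by rewrite conj_triE det_mx2; ring. Qed.

Lemma tr_conj_tri x y l w k : \tr (conj_tri x y l w k) = l + k.
Proof. by rewrite conj_triE tr_mx2; ring. Qed.

Lemma mul_conj_tri x y l w k l' w' k' :
  conj_tri x y l w k *m conj_tri x y l' w' k' =
  conj_tri x y (l * l') (l * w' + w * k') (k * k').
Proof. by rewrite !conj_triE mul_mx2; congr mx2; ring. Qed.

Lemma conj_tri_inj x y l w k l' w' k' :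
  conj_tri x y l w k = conj_tri x y l' w' k' -> [/\ l = l', w = w' & k = k'].
Proof.
rewrite !conj_triE => /mx2_inj[e1 e2 e3 e4].
have ew : w = w'.
  move: e1 e2 e3 e4; set c := y * _; set c' := y * (l' - _ - _) => e1 e2 e3 e4.
  have -> : w = (w + x * (k + y * w) - x * (l - w * y + x * c))
      - x * (k + y * w - x * c) + x * (l - w * y + x * c) - x ^+ 2 * c by ring.
  by rewrite e2 e1 e4 e3; ring.
rewrite ew in e1 e2 e3 e4 *; rewrite e3 in e1 e2 e4.
by move: e1 e4 => /addIr/addIr-> /addIr/addIr->.
Qed.

Lemma conj_tri_pow x y l w k n :
  exists w', conj_tri x y l w k ^+ n = conj_tri x y (l ^+ n) w' (k ^+ n).
Proof.
elim: n => [|n [w' IH]].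
  exists 0; rewrite !expr0 conj_triE; apply/matrixP => i j; rewrite !mxE.
  by case: (unliftP ord0 i) (unliftP ord0 j) => [i' ->|->] [j' ->|->];
    rewrite ?(ord1 i') ?(ord1 j') /=; ring.
by exists (l * w' + w * k ^+ n); rewrite !exprS IH; exact: mul_conj_tri.
Qed.

(** The equation says that the line spanned by (u, 1) is stable; it is the
    image of the first basis vector when x = u - 1 and y = 1. *)
Lemma eigenline_conj_tri a b c d u : c * u ^+ 2 + (d - a) * u - b = 0 ->
  exists l w k, mx2 a b c d = conj_tri (u - 1) 1 l w k.
Proof.
move=> e; exists (c * u + d), (c * u + d - (a - c * u) - c), (a - c * u).
rewrite conj_triE; congr mx2; rewrite ?mul1r; try ring.
have -> : b = c * u ^+ 2 + (d - a) * u by apply/esym/eqP; rewrite -subr_eq0 e.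
by ring.
Qed.

(** If c <> 0, then y = 1 puts the eigenline of l in the right place.  If c = 0,
    then a is l or k: the matrix is already triangular with l first, or it is
    reached with y = 1 and w = l - k, which makes the lower left entry vanish. *)
Lemma conj_tri_param A l k : l != k -> \tr A = l + k -> \det A = l * k ->
  exists (y : bool) x w, A = conj_tri x y%:R l w k.
Proof.
move=> lk; have [a [b [c [d ->]]]] := mx2P A; rewrite tr_mx2 det_mx2 => tE dE.
have {tE} dd : d = l + k - a by rewrite -tE; ring.
have d0 : l - k != 0 by rewrite subr_eq0.
rewrite {d}dd in dE *; have [c0|c0] := eqVneq c 0.
  rewrite {c}c0 in dE *.
  have /eqP : (a - l) * (a - k) = 0.
    by transitivity (l * k - (a * (l + k - a) - b * 0)); [ring|rewrite dE subrr].
  rewrite mulf_eq0 !subr_eq0 => /orP[] /eqP ->.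
    by exists false, 0, b; rewrite conj_triE /=; congr mx2; ring.
  by exists true, (b / (l - k) - 1), (l - k); rewrite conj_triE /=; congr mx2; field.
have bE : b = (a * (l + k - a) - l * k) / c.
  by rewrite -dE; field.
exists true, ((a - k - c) / c), (l - k - c); rewrite conj_triE {}bE /=.
by congr mx2; field.
Qed.

Lemma commute_mx2 a b c d a' b' c' d' :
  mx2 a b c d *m mx2 a' b' c' d' = mx2 a' b' c' d' *m mx2 a b c d ->
  [/\ b * c' = b' * c, b * (d' - a') = b' * (d - a)
    & c * (d' - a') = c' * (d - a)].
Proof.
rewrite !mul_mx2 => /mx2_inj[e1 e2 e3 e4]; split.
- by apply: (addrI (a * a')); rewrite e1; ring.
- apply/eqP; rewrite -subr_eq0; apply/eqP.
  by transitivity ((a * b' + b * d') - (a' * b + b' * d)); [ring|rewrite e2 subrr].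
- apply/eqP; rewrite -subr_eq0; apply/eqP.
  by transitivity ((c' * a + d' * c) - (c * a' + d * c')); [ring|rewrite e3 subrr].
Qed.

(** The remainder c X + e of X^n modulo the characteristic polynomial can be
    evaluated at the matrix and at the eigenvalues; for a double eigenvalue its
    slope is the derivative of X^n. *)
Lemma mx2_pow A l k n : \tr A = l + k -> \det A = l * k ->
  exists c e, [/\ A ^+ n = c *: A + e%:M, l ^+ n = c * l + e,
    k ^+ n = c * k + e & l = k -> c = n%:R * l ^+ n.-1].
Proof.
have [a [b [c [d ->]]]] := mx2P A; rewrite tr_mx2 det_mx2 => tE dE.
elim: n => [|n [x [y [IH1 IH2 IH3 IH4]]]].
  by exists 0, 1; rewrite !expr0 scale0r !mul0r !add0r.
exists (x * (l + k) + y), (- x * (l * k)); split.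
- rewrite exprSr IH1 -mulmxE mulmxDl -scalemxAl mul_scalar_mx -tE -dE mul_mx2.
  apply/matrixP => i j; rewrite !mxE.
  by case: (unliftP ord0 i) (unliftP ord0 j) => [i' ->|->] [j' ->|->];
    rewrite ?(ord1 i') ?(ord1 j') /=; ring.
- by rewrite exprSr IH2; ring.
- by rewrite exprSr IH3; ring.
- move=> lk; rewrite -lk in IH2 IH3 IH4 *.
  have -> : x * (l + l) + y = x * l + (x * l + y) by ring.
  rewrite -IH2 (IH4 erefl) -mulrA -exprSr.
  case: (n) => [|m] /=; first by rewrite mul0r add0r mul1r.
  by rewrite -[m.+2%:R]natr1 mulrDl mul1r.
Qed.

End TwoByTwo.

Section ClosedField.
Variable K : closedFieldType.
Implicit Types (A B : 'M[K]_2).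

Lemma quadratic_root (a b c : K) : a != 0 -> exists u, a * u ^+ 2 + b * u - c = 0.
Proof.
move=> a0; have [//|u hu] := @solve_monicpoly K 2
  (fun i => if i == 0%N then c / a else - b / a).
exists u; rewrite hu !big_ord_recl big_ord0 /=; rewrite expr0 expr1; by field.
Qed.

(** For commuting matrices the vectors (b, d - a, c) are proportional, so the
    quadratic equations of their stable lines have a common root, unless both
    matrices are already triangular. *)
Lemma commuting_conj_tri A B : A *m B = B *m A ->
  exists (y : bool) x l w k l' w' k',
    A = conj_tri x y%:R l w k /\ B = conj_tri x y%:R l' w' k'.
Proof.
have [a [b [c [d ->]]]] := mx2P A; have [a' [b' [c' [d' ->]]]] := mx2P B.
move/commute_mx2 => [e1 e2 e3].
have [c0|c0] := eqVneq c 0; last first.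
  have [u hu] := quadratic_root (d - a) b c0.
  have hu' : c' * u ^+ 2 + (d' - a') * u - b' = 0.
    apply: (mulfI c0); rewrite mulr0.
    transitivity (c' * (c * u ^+ 2) + (c * (d' - a')) * u - b' * c); first by ring.
    by rewrite e3 -e1; transitivity (c' * (c * u ^+ 2 + (d - a) * u - b));
      [ring|rewrite hu mulr0].
  have [l [w [k ->]]] := eigenline_conj_tri hu.
  by have [l' [w' [k' ->]]] := eigenline_conj_tri hu';
    exists true, (u - 1), l, w, k, l', w', k'.
have [c'0|c'0] := eqVneq c' 0; last first.
  have [u hu'] := quadratic_root (d' - a') b' c'0.
  have hu : c * u ^+ 2 + (d - a) * u - b = 0.
    apply: (mulfI c'0); rewrite mulr0.
    transitivity (c * (c' * u ^+ 2) + (c' * (d - a)) * u - b * c'); first by ring.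
    by rewrite -e3 e1; transitivity (c * (c' * u ^+ 2 + (d' - a') * u - b'));
      [ring|rewrite hu' mulr0].
  have [l [w [k ->]]] := eigenline_conj_tri hu.
  by have [l' [w' [k' ->]]] := eigenline_conj_tri hu';
    exists true, (u - 1), l, w, k, l', w', k'.
by exists false, 0, a, b, d, a', b', d'; rewrite c0 c'0 !conj_triE /=;
  split; congr mx2; ring.
Qed.

(** For triangular matrices with diagonals (l, 1/l) and (m, 1/m) the equations
    become l^p = m^t, and, for commutation, proportionality of the upper right
    entries to (l - 1/l, m - 1/m).  An s with s^t = l makes m / s^p a t-th root of
    unity.  The proportionality says nothing exactly when l and m are 1 or -1; this
    is the second case. *)
Lemma commuting_param A B p t (z : K) : (0 < t)%N -> t.-primitive_root z ->
  \det A = 1 -> \det B = 1 -> A ^+ p = B ^+ t -> A *m B = B *m A ->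
  (exists (y : bool) (j : 'I_t) x r s, let m := z ^+ j * s ^+ p in
    [/\ s != 0, A = conj_tri x y%:R (s ^+ t) (r * (s ^+ t - (s ^+ t)^-1)) (s ^+ t)^-1
      & B = conj_tri x y%:R m (r * (m - m^-1)) m^-1]) \/
  (exists (y e e' : bool) x u w,
     A = conj_tri x y%:R ((-1) ^+ e) u ((-1) ^+ e) /\
     B = conj_tri x y%:R ((-1) ^+ e') w ((-1) ^+ e')).
Proof.
move=> t0 zt dA dB AB /[dup] comm /commuting_conj_tri.
move=> [y [x [l [w [k [l' [w' [k' [Ae Be]]]]]]]]].
move: dA dB comm AB; rewrite {}Ae {}Be !det_conj_tri !mul_conj_tri => dA dB.
move=> /conj_tri_inj[_ wE _].
have [w1 ->] := conj_tri_pow x y%:R l w k p.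
have [w2 ->] := conj_tri_pow x y%:R l' w' k' t.
move=> /conj_tri_inj[lpt _ _] {w1 w2}.
have l0 : l != 0 by apply: contra_eq_neq dA => ->; rewrite mul0r eq_sym oner_eq0.
have l'0 : l' != 0 by apply: contra_eq_neq dB => ->; rewrite mul0r eq_sym oner_eq0.
have kE : k = l^-1 by apply: (mulfI l0); rewrite dA divff.
have k'E : k' = l'^-1 by apply: (mulfI l'0); rewrite dB divff.
have {}wE : w' * (l - k) = w * (l' - k').
  apply/eqP; rewrite -subr_eq0; apply/eqP.
  by transitivity (l * w' + w * k' - (l' * w + w' * k)); [ring|rewrite wE subrr].
have sgn (m : K) : m * m = 1 -> exists e : bool, m = (-1) ^+ e.
  by move/eqP; rewrite -expr2 sqrf_eq1 => /orP[] /eqP ->; [exists false|exists true].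
have generic r : w = r * (l - k) -> w' = r * (l' - k') ->
  exists (y0 : bool) (j : 'I_t) x0 r s, let m := z ^+ j * s ^+ p in
    [/\ s != 0, conj_tri x y%:R l w k =
          conj_tri x0 y0%:R (s ^+ t) (r * (s ^+ t - (s ^+ t)^-1)) (s ^+ t)^-1
      & conj_tri x y%:R l' w' k' = conj_tri x0 y0%:R m (r * (m - m^-1)) m^-1].
  move=> -> ->.
  have [s sE] : exists s, s ^+ t = l.
    have [//|s] := @solve_monicpoly K t (fun i => if i == 0%N then l else 0).
    rewrite (bigD1 (Ordinal t0)) //= expr0 mulr1 big1 ?addr0; first by exists s.
    by move=> i i0; rewrite ifN ?mul0r.
  have s0 : s != 0 by move: l0; rewrite -sE expf_eq0 t0.
  have /(prim_rootP zt)[j jE] : (l' / s ^+ p) ^+ t = 1.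
    by rewrite exprMn exprVn -lpt -sE exprAC divff // !expf_neq0.
  exists y, j, x, r, s; rewrite /= -jE divfK ?expf_neq0 // sE -kE.
  by split=> //; rewrite k'E.
have [lk|lk] := eqVneq l k; last first.
  left; apply: (generic (w / (l - k))); first by rewrite divfK ?subr_eq0.
  by rewrite mulrAC -wE mulfK ?subr_eq0.
have [l'k'|l'k'] := eqVneq l' k'; last first.
  left; apply: (generic (w' / (l' - k'))); last by rewrite divfK ?subr_eq0.
  by rewrite mulrAC wE mulfK ?subr_eq0.
right; rewrite -lk in dA *; rewrite -l'k' in dB *.
have [e ->] := sgn l dA; have [e' ->] := sgn l' dB.
by exists y, e, e', x, w, w'.
Qed.

End ClosedField.

(** * Traces of the noncommuting pairs *)

Section RootsOfUnity.
Variable K : numClosedFieldType.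

Lemma prim_root_exists n : (0 < n)%N -> exists z : K, n.-primitive_root z.
Proof.
move=> n0; pose q : {poly K} := 'X^n - 1.
have [r Dq] := closed_field_poly_normal q.
rewrite (monicP _) ?monicXnsubC // scale1r in Dq.
have rn1 : all n.-unity_root r by apply/allP => z; rewrite -root_prod_XsubC -Dq.
have sz_r : (n < (size r).+1)%N.
  by rewrite -(size_prod_XsubC r id) -Dq size_XnsubC.
have [|z] := hasP (has_prim_root n0 rn1 _ sz_r); last by exists z.
by rewrite -separable_prod_XsubC -Dq separable_Xn_sub_1 // Num.Theory.pnatr_eq0 -lt0n.
Qed.

Lemma prim_root_neq0 n (z : K) : n.-primitive_root z -> z != 0.
Proof.
move=> zn; have := prim_expr_order zn; apply: contra_eq_neq => ->.
by rewrite expr0n gtn_eqF ?(prim_order_gt0 zn) // eq_sym oner_eq0.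
Qed.

Lemma prim_root_half n (z : K) : (2 * n).-primitive_root z -> z ^+ n = -1.
Proof.
move=> zn; have n0 : (0 < n)%N by have := prim_order_gt0 zn; rewrite muln_gt0.
have /eqP : z ^+ n ^+ 2 = 1 by rewrite -exprM mulnC prim_expr_order.
rewrite sqrf_eq1 -(prim_order_dvd zn) gtnNdvd //= ?mul2n -?addnn; last by lia.
by move/eqP.
Qed.

Lemma prim_root_powV_neq n (z : K) k : (2 * n).-primitive_root z ->
  (0 < k < n)%N -> z ^+ k != (z ^+ k)^-1.
Proof.
move=> zn /andP[k0 kn]; have z0 := prim_root_neq0 zn.
rewrite -(inj_eq (mulIf (expf_neq0 k z0))) mulVf ?expf_neq0 // -exprD.
by rewrite -(prim_order_dvd zn) gtnNdvd //; lia.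
Qed.

Lemma prim_root_trace_inj n (z : K) k k' : (2 * n).-primitive_root z ->
  (0 < k < n)%N -> (0 < k' < n)%N ->
  z ^+ k + (z ^+ k)^-1 = z ^+ k' + (z ^+ k')^-1 -> k = k'.
Proof.
move=> zn /andP[k0 kn] /andP[k'0 k'n] e; have z0 := prim_root_neq0 zn.
have u0 := expf_neq0 k z0; have v0 := expf_neq0 k' z0.
have /eqP : (z ^+ k - z ^+ k') * (z ^+ k * z ^+ k' - 1) = 0.
  transitivity (z ^+ k * z ^+ k' *
    (z ^+ k + (z ^+ k)^-1 - (z ^+ k' + (z ^+ k')^-1))); first by field; apply/andP.
  by rewrite e subrr mulr0.
rewrite mulf_eq0 !subr_eq0 -exprD -(prim_order_dvd zn) (eq_prim_root_expr zn).
rewrite !modn_small ?gtnNdvd ?orbF; lia.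
Qed.

(** Here l is a power z^j with 0 <= j < 2n; exchanging l with its inverse brings
    j below n, and j = 0, j = n are excluded as l is not its own inverse. *)
Lemma trace_of_root n (z l : K) : (2 * n).-primitive_root z ->
  l != 0 -> l != l^-1 -> l ^+ n = l^-1 ^+ n ->
  exists k, [/\ (0 < k < n)%N, l + l^-1 = z ^+ k + (z ^+ k)^-1 &
    l ^+ n = (-1) ^+ k].
Proof.
move=> zn l0 ll ln; have z0 := prim_root_neq0 zn; have zh := prim_root_half zn.
have l2n : l ^+ (2 * n) = 1.
  by rewrite mul2n -addnn exprD {2}ln exprVn mulfV ?expf_neq0.
have [[j jn] /= lE] := prim_rootP zn l2n.
have j0 : j != 0%N by apply: contra_neq ll => j0; rewrite lE j0 expr0 invr1.
have jn' : j != n.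
  by apply: contra_neq ll => jn'; rewrite lE jn' zh invrN invr1.
have pow : l ^+ n = (-1) ^+ j by rewrite lE exprAC zh.
have [jln|nlj] := ltnP j n; first by exists j; split; [lia|rewrite lE|].
exists (2 * n - j)%N; split; first by lia.
  have zV : z ^+ (2 * n - j) = l^-1.
    by rewrite expfB // (prim_expr_order zn) mul1r lE.
  by rewrite zV invrK addrC.
rewrite pow -signr_odd -[in RHS]signr_odd oddB; last by lia.
by rewrite oddM.
Qed.

(** Write A^p = c A + e.  As A^p = B^t commutes with B while A does not, c = 0,
    so both eigenvalues of A have p-th power e; they are distinct because in
    characteristic 0 the slope c is nonzero at a double eigenvalue.  The
    argument is symmetric in A and B, and the two scalars agree. *)
Lemma noncommuting_traces p t (z z' : K) (A B : 'M[K]_2) :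
  (2 * p).-primitive_root z -> (2 * t).-primitive_root z' ->
  \det A = 1 -> \det B = 1 -> A ^+ p = B ^+ t -> A *m B <> B *m A ->
  exists k k', [/\ (0 < k < p)%N, (0 < k' < t)%N, odd k = odd k',
    \tr A = z ^+ k + (z ^+ k)^-1 & \tr B = z' ^+ k' + (z' ^+ k')^-1].
Proof.
move=> zp zt; wlog suff W : p t z z' A B zp zt / \det A = 1 -> A ^+ p = B ^+ t ->
    A *m B <> B *m A ->
    exists k, [/\ (0 < k < p)%N, \tr A = z ^+ k + (z ^+ k)^-1 &
      A ^+ p = ((-1) ^+ k)%:M].
  move=> dA dB AB nAB; have [k [kp tA Ak]] := W _ _ _ _ _ _ zp zt dA AB nAB.
  have [k' [kt tB Bk]] := W _ _ _ _ _ _ zt zp dB (esym AB) (nesym nAB).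
  exists k, k'; split=> //; move: AB; rewrite Ak Bk => /matrixP/(_ ord0 ord0).
  rewrite !mxE eqxx !mulr1n -signr_odd -[in RHS]signr_odd => /eqP.
  by rewrite (inj_eq (@Num.Theory.signr_inj K)) => /eqP.
move=> dA AB nAB.
have [y [x [l [w [k [_ [_ [_ [Ae _]]]]]]]]] := commuting_conj_tri (erefl (A *m A)).
have tE : \tr A = l + k by rewrite Ae tr_conj_tri.
have dE : \det A = l * k by rewrite Ae det_conj_tri.
have lk1 : l * k = 1 by rewrite -dE.
have l0 : l != 0 by apply: contra_eq_neq lk1 => ->; rewrite mul0r eq_sym oner_eq0.
have kE : k = l^-1 by apply: (mulfI l0); rewrite lk1 divff.
have [c [e [Ap lp kp lkc]]] := mx2_pow p tE dE.
have c0 : c = 0.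
  apply/eqP; apply: contra_notT nAB => c0; apply: (scalerI c0).
  have : A ^+ p *m B = B *m A ^+ p by rewrite AB !mulmxE -exprS -exprSr.
  rewrite Ap mulmxDl mulmxDr mul_scalar_mx mul_mx_scalar => /addIr.
  by rewrite -scalemxAl -scalemxAr.
move: Ap lp kp lkc; rewrite {c}c0 scale0r !mul0r !add0r => Ap lp kp lkc.
have p0 : (0 < p)%N by have := prim_order_gt0 zp; rewrite muln_gt0.
have lk : l != l^-1.
  apply/eqP => lk; have /esym/eqP := lkc (etrans lk (esym kE)).
  by rewrite mulf_eq0 Num.Theory.pnatr_eq0 expf_eq0 (negPf l0) andbF orbF -leqn0 leqNgt p0.
have [|j [jp lj pj]] := trace_of_root zp l0 lk _; first by rewrite -kE lp kp.
by exists j; rewrite tE kE; split; rewrite // Ap -lp pj.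
Qed.

End RootsOfUnity.

(** * Pairs of matrices as points *)

Section Coordinates.
Variable K : fieldType.

Definition mx_of_coords (v : 'rV[K]_(2 * (2 * 2))) (i : 'I_2) : 'M[K]_2 :=
  vec_mx (row i (vec_mx v)).

Definition mx_pair (A B : 'M[K]_2) : 'rV[K]_(2 * (2 * 2)) :=
  mx_coords (fun i => if i == ord0 then A else B).

Lemma mx_coordsK (m : 'I_2 -> 'M[K]_2) i : mx_of_coords (mx_coords m) i = m i.
Proof. by rewrite /mx_of_coords /mx_coords mxvecK rowK mxvecK. Qed.

Lemma mx_of_coordsK (v : 'rV[K]_(2 * (2 * 2))) : mx_coords (mx_of_coords v) = v.
Proof.
rewrite /mx_coords -[RHS]vec_mxK; congr mxvec; apply/row_matrixP => i.
by rewrite rowK vec_mxK.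
Qed.

Lemma mx_pairK (v : 'rV[K]_(2 * (2 * 2))) :
  mx_pair (mx_of_coords v ord0) (mx_of_coords v ord_max) = v.
Proof.
rewrite -[RHS]mx_of_coordsK; congr mx_coords; apply/funext => i.
case: (unliftP ord0 i) => [j ->|->] //=.
by congr mx_of_coords; apply: val_inj; rewrite /= (ord1 j).
Qed.

Lemma mx_pair_fst A B : mx_of_coords (mx_pair A B) ord0 = A.
Proof. by rewrite mx_coordsK. Qed.

Lemma mx_pair_snd A B : mx_of_coords (mx_pair A B) ord_max = B.
Proof. by rewrite mx_coordsK. Qed.

Lemma repr_variety_pair p t : repr_variety K (Gpt_gen p t) =
  [set v | [/\ \det (mx_of_coords v ord0) = 1, \det (mx_of_coords v ord_max) = 1 &
    mx_of_coords v ord0 ^+ p = mx_of_coords v ord_max ^+ t]]%classic.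
Proof.
rewrite repr_variety_Gpt; apply/seteqP; split=> v /=.
  by move=> [m [d0 d1 e ->]]; rewrite !mx_coordsK.
by move=> [d0 d1 e]; exists (mx_of_coords v); rewrite mx_of_coordsK.
Qed.

Definition regular_mx d (H : {mpoly K[d]}) (M : 'rV[K]_d -> 'M[K]_2) : Prop :=
  forall i j, regular_on H (fun v => M v i j).

Lemma regular_mx_of_coords i :
  regular_mx 1 (fun v : 'rV[K]_(2 * (2 * 2)) => mx_of_coords v i).
Proof. by move=> j k; under eq_fun do rewrite !mxE; apply: regular_coord. Qed.

Section RegularMatrices.
Variables (d : nat) (H : {mpoly K[d]}).

Lemma regular_mulmx M M' : regular_mx H M -> regular_mx H M' ->
  regular_mx H (fun v => M v *m M' v).
Proof.
move=> hM hM' i j; under eq_fun do rewrite mxE.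
by apply: regular_sum => k; apply: regularM.
Qed.

Lemma regular_mx2 fa fb fc fd : regular_on H fa -> regular_on H fb ->
  regular_on H fc -> regular_on H fd ->
  regular_mx H (fun v => mx2 (fa v) (fb v) (fc v) (fd v)).
Proof.
move=> ha hb hc hd i j; under eq_fun do rewrite mxE.
by case: (i == _); case: (j == _).
Qed.

Lemma regular_conj_tri fx fy fl fw fk : regular_on H fx -> regular_on H fy ->
  regular_on H fl -> regular_on H fw -> regular_on H fk ->
  regular_mx H (fun v => conj_tri (fx v) (fy v) (fl v) (fw v) (fk v)).
Proof.
have [r0 r1] : regular_on H (fun=> 0) /\ regular_on H (fun=> 1).
  by split; apply: regular_const.
move=> hx hy hl hw hk; do !apply: regular_mulmx.
all: by apply: regular_mx2 => //; apply: regularN.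
Qed.

Lemma regular_mx_pair M M' : regular_mx H M -> regular_mx H M' ->
  forall n, regular_on H (fun v => mx_pair (M v) (M' v) ord0 n).
Proof.
move=> hM hM' n; case/mxvec_indexP: n => i jk; case/mxvec_indexP: jk => j k.
by under eq_fun do rewrite /mx_pair /mx_coords mxvecE mxE mxvecE; case: (i == _).
Qed.

End RegularMatrices.
End Coordinates.

(** * Products of conjugacy classes *)

Section Strata.
Variable K : fieldType.
Implicit Types (l k : K) (A : 'M[K]_2).
Local Open Scope classical_set_scope.

(** For l <> k, a flag in the conjugacy class of diag (l, k): a point, a line, and the whole
    class from r = 2 on. *)
Definition stratum r l k : set 'M[K]_2 :=
  if r is r'.+1 then
    if r' is _.+1 then [set A | \tr A = l + k /\ \det A = l * k]
    else [set A | [/\ A ord0 ord0 = l, A ord_max ord0 = 0 & A ord_max ord_max = k]]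
  else [set A | [/\ A ord0 ord0 = l, A ord_max ord0 = 0, A ord_max ord_max = k &
    A ord0 ord_max = 0]].

(** Each stratum is the image of a coordinate subspace of the (x, y, w)-space,
    whence its irreducibility. *)
Lemma stratum_param r l k A : l != k -> stratum r l k A <->
  exists x y w, A = conj_tri (x *+ (1 < r)) (y *+ (1 < r)) l (w *+ (0 < r)) k.
Proof.
move=> lk; case: r => [|[|r]] /=; split.
- have [a [b [c [d ->]]]] := mx2P A; rewrite !mxE => -[] /= -> -> -> ->.
  by exists 0, 0, 0; rewrite conj_triE; congr mx2; ring.
- by move=> [x [y [w ->]]]; rewrite conj_triE !mxE /=; split; ring.
- have [a [b [c [d ->]]]] := mx2P A; rewrite !mxE => -[] /= -> -> ->.
  by exists 0, 0, b; rewrite conj_triE; congr mx2; ring.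
- by move=> [x [y [w ->]]]; rewrite conj_triE !mxE /=; split; ring.
- by move=> [tA dA]; have [y [x [w ->]]] := conj_tri_param lk tA dA; exists x, y%:R, w.
- by move=> [x [y [w ->]]]; rewrite tr_conj_tri det_conj_tri.
Qed.

Lemma stratum_diag r l k : stratum r l k (mx2 l 0 0 k).
Proof.
by case: r => [|[|r]] /=; rewrite ?tr_mx2 ?det_mx2 ?mxE ?mul0r ?subr0.
Qed.

Lemma stratum_proper r l k : (r < 2)%N -> stratum r l k `<` stratum r.+1 l k.
Proof.
case: r => [|[|//]] _; split=> /=.
- by move=> A [].
- by move=> /(_ (mx2 l 1 0 k)); rewrite /= !mxE /= => -[//|_ _ _ /eqP]; rewrite oner_eq0.
- move=> A; have [a [b [c [d ->]]]] := mx2P A; rewrite /= tr_mx2 det_mx2 !mxE /=.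
  by move=> [-> -> ->]; rewrite mulr0 subr0.
- move=> /(_ (mx2 l 0 1 k)); rewrite /= tr_mx2 det_mx2 !mxE /= mul0r subr0.
  by move=> [//|_ /eqP]; rewrite oner_eq0.
Qed.

Definition stratum_pair r s l k l' k' : set 'rV[K]_(2 * (2 * 2)) :=
  [set v | stratum r l k (mx_of_coords v ord0) /\
           stratum s l' k' (mx_of_coords v ord_max)].

Lemma stratum_pair_closed r s l k l' k' :
  zariski_closed (stratum_pair r s l k l' k').
Proof.
have closed1 q i (l0 k0 : K) : zariski_closed
    [set v : 'rV[K]_(2 * (2 * 2)) | stratum q l0 k0 (mx_of_coords v i)].
  have hM := @regular_mx_of_coords K i.
  have entry (a b : 'I_2) (c : K) : zariski_closed
      [set v : 'rV[K]_(2 * (2 * 2)) | mx_of_coords v i a b = c].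
    by apply: zariski_closed_eq; [exact: hM|exact: regular_const].
  case: q => [|[|q]] /=.
  - have := zariski_closedI (zariski_closedI (entry ord0 ord0 l0) (entry ord_max ord0 0))
      (zariski_closedI (entry ord_max ord_max k0) (entry ord0 ord_max 0)).
    by congr zariski_closed; apply/seteqP; split=> v /=; [move=> [[? ?] [? ?]]|case].
  - have := zariski_closedI (zariski_closedI (entry ord0 ord0 l0) (entry ord_max ord0 0))
      (entry ord_max ord_max k0).
    by congr zariski_closed; apply/seteqP; split=> v /=; [move=> [[? ?] ?]|case].
  apply: zariski_closedI; apply: zariski_closed_eq; try exact: regular_const.
    by rewrite /mxtrace; apply: regular_sum.
  rewrite /determinant; apply: regular_sum => sg; apply: regularM.
    exact: regular_const.
  exact: regular_prod.
exact: zariski_closedI (closed1 r ord0 l k) (closed1 s ord_max l' k').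
Qed.

Lemma stratum_pair_irreducible r s l k l' k' : [pchar K] =i pred0 ->
  l != k -> l' != k' -> zariski_irreducible (stratum_pair r s l k l' k').
Proof.
move=> K0 lk lk'.
pose phi (u : 'rV[K]_6) := mx_pair
  (conj_tri (u ord0 (inord 0) *+ (1 < r)) (u ord0 (inord 1) *+ (1 < r)) l
     (u ord0 (inord 2) *+ (0 < r)) k)
  (conj_tri (u ord0 (inord 3) *+ (1 < s)) (u ord0 (inord 4) *+ (1 < s)) l'
     (u ord0 (inord 5) *+ (0 < s)) k').
have -> : stratum_pair r s l k l' k' = range phi.
  apply/seteqP; split=> v; last first.
    move=> [u _ <-]; rewrite /stratum_pair /= mx_pair_fst mx_pair_snd.
    by split; apply/stratum_param => //; do 3!eexists.
  move=> [/(stratum_param _ _ lk)[x [y [w e]]] /(stratum_param _ _ lk')[x' [y' [w' e']]]].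
  exists (\row_i nth 0 [:: x; y; w; x'; y'; w'] i) => //.
  by rewrite /phi !mxE !inordK //= -e -e' mx_pairK.
apply: (irreducible_image K0); apply: regular_mx_pair; apply: regular_conj_tri;
  try exact: regular_const.
all: by under eq_fun do rewrite -mulr_natr; apply: regularM;
  [exact: regular_coord|exact: regular_const].
Qed.

(** With y and y' equal to 0 or 1, four charts with two parameters for each
    factor suffice. *)
Lemma stratum_pair_dim_le l k l' k' : l != k -> l' != k' ->
  alg_dim_le 4 (stratum_pair 2 2 l k l' k').
Proof.
move=> lk lk'.
pose phi (y : bool * bool) (u : 'rV[K]_4) := mx_pair
  (conj_tri (u ord0 (inord 0)) y.1%:R l (u ord0 (inord 1)) k)
  (conj_tri (u ord0 (inord 2)) y.2%:R l' (u ord0 (inord 3)) k').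
have sub : stratum_pair 2 2 l k l' k' `<=`
    \bigcup_(y : bool * bool) phi y @` [set v : 'rV[K]_4 | (1 : {mpoly K[4]}).@[v ord0] != 0].
  move=> v [[tA dA] [tB dB]].
  have [y [x [w eA]]] := conj_tri_param lk tA dA.
  have [y' [x' [w' eB]]] := conj_tri_param lk' tB dB.
  exists (y, y') => //; exists (\row_i nth 0 [:: x; w; x'; w'] i).
    by rewrite /= meval1 oner_eq0.
  by rewrite /phi !mxE !inordK //= -eA -eB mx_pairK.
apply: alg_dim_leS sub _; apply: alg_dim_le_bigcup => y; apply: alg_dim_le_chart.
by apply: regular_mx_pair; apply: regular_conj_tri;
  do ?[exact: regular_const|exact: regular_coord].
Qed.

Lemma stratum_pair_dim l k l' k' : [pchar K] =i pred0 -> l != k -> l' != k' ->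
  zariski_dim (stratum_pair 2 2 l k l' k') 4.
Proof.
move=> K0 lk lk'; split; last first.
  move=> e C chainC; apply: (chain_length_le (stratum_pair_dim_le lk lk') chainC).
  by have [irrC _] := chainC; have [] := irrC e (leqnn e).
(* the indices (r, s) run through (0, 0), (1, 0), (1, 1), (2, 1), (2, 2) *)
exists (fun i => stratum_pair (uphalf i) i./2 l k l' k').
have properl r s : (r < 2)%N ->
    stratum_pair r s l k l' k' `<` stratum_pair r.+1 s l k l' k'.
  move=> r2; have [sub nsub] := stratum_proper l k r2; split.
    by move=> v [/sub].
  move=> sub'; apply: nsub => A hA.
  have := sub' (mx_pair A (mx2 l' 0 0 k')).
  rewrite /stratum_pair /= mx_pair_fst mx_pair_snd => -[] //.
  by split=> //; exact: stratum_diag.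
have properr r s : (s < 2)%N ->
    stratum_pair r s l k l' k' `<` stratum_pair r s.+1 l k l' k'.
  move=> s2; have [sub nsub] := stratum_proper l' k' s2; split.
    by move=> v [? /sub].
  move=> sub'; apply: nsub => B hB.
  have := sub' (mx_pair (mx2 l 0 0 k) B).
  rewrite /stratum_pair /= mx_pair_fst mx_pair_snd => -[] //.
  by split=> //; exact: stratum_diag.
have step i : (i < 4)%N -> stratum_pair (uphalf i) i./2 l k l' k' `<`
    stratum_pair (uphalf i.+1) i.+1./2 l k l' k'.
  by case: i => [|[|[|[|//]]]] _; [exact: properl|exact: properr|exact: properl|exact: properr].
split=> [i i4|//]; split; [|exact: stratum_pair_closed|exact: stratum_pair_irreducible].
have mono j : (i + j <= 4)%N -> stratum_pair (uphalf i) i./2 l k l' k' `<=`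
    stratum_pair (uphalf (i + j)) (i + j)./2 l k l' k'.
  elim: j => [|j IH] ij; first by rewrite addn0.
  apply: subset_trans (IH _) _; first by lia.
  by rewrite addnS; case: (step (i + j)%N); first by lia.
by have := mono (4 - i)%N; rewrite subnKC //; apply.
Qed.

End Strata.

(** * The components of dimension four *)

Definition trace_index p t : {set 'I_p * 'I_t} :=
  [set kk : 'I_p * 'I_t | [&& 0 < kk.1, 0 < kk.2 & odd kk.1 == odd kk.2]%N].

Section Variety.
Variable K : numClosedFieldType.
Local Open Scope classical_set_scope.

Lemma commuting_pairs_dim_le p t : (0 < t)%N ->
  alg_dim_le 3 (repr_variety K (Gpt_gen p t) `&`
    [set v | mx_of_coords v ord0 *m mx_of_coords v ord_max =
             mx_of_coords v ord_max *m mx_of_coords v ord0]).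
Proof.
move=> t0; have [z zt] := prim_root_exists K t0.
pose root_of_unity_chart (y : bool) (j : 'I_t) (u : 'rV[K]_3) :=
  let s := u ord0 (inord 2) in let m := z ^+ j * s ^+ p in
  mx_pair (conj_tri (u ord0 (inord 0)) y%:R (s ^+ t)
             (u ord0 (inord 1) * (s ^+ t - (s ^+ t)^-1)) (s ^+ t)^-1)
          (conj_tri (u ord0 (inord 0)) y%:R m
             (u ord0 (inord 1) * (m - m^-1)) m^-1).
pose unipotent_chart (y e e' : bool) (u : 'rV[K]_3) :=
  mx_pair (conj_tri (u ord0 (inord 0)) y%:R ((-1) ^+ e) (u ord0 (inord 1)) ((-1) ^+ e))
          (conj_tri (u ord0 (inord 0)) y%:R ((-1) ^+ e') (u ord0 (inord 2)) ((-1) ^+ e')).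
pose H : {mpoly K[3]} := 'X_(inord 2).
pose F (i : (bool * 'I_t) + (bool * bool * bool)) :=
  match i with
  | inl (y, j) => root_of_unity_chart y j @` [set u : 'rV[K]_3 | H.@[u ord0] != 0]
  | inr (y, e, e') =>
    unipotent_chart y e e' @` [set u : 'rV[K]_3 | (1 : {mpoly K[3]}).@[u ord0] != 0]
  end.
apply: (@alg_dim_leS _ _ _ _ (\bigcup_i F i)).
  move=> v []; rewrite repr_variety_pair => -[dA dB AB] comm.
  case: (commuting_param t0 zt dA dB AB comm) => [[y [j [x [r [s [s0 eA eB]]]]]]|].
    exists (inl (y, j)) => //; exists (\row_i nth 0 [:: x; r; s] i).
      by rewrite /= mevalXU mxE inordK.
    by rewrite /root_of_unity_chart !mxE !inordK //= -eA -eB mx_pairK.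
  move=> [y [e [e' [x [u [w [eA eB]]]]]]].
  exists (inr (y, e, e')) => //; exists (\row_i nth 0 [:: x; u; w] i).
    by rewrite /= meval1 oner_eq0.
  by rewrite /unipotent_chart !mxE !inordK //= -eA -eB mx_pairK.
apply: alg_dim_le_bigcup => -[[y j]|[[y e] e']]; apply: alg_dim_le_chart; last first.
  by apply: regular_mx_pair; apply: regular_conj_tri;
    do ?[exact: regular_const|exact: regular_coord].
have regV : regular_on H (fun u => (u ord0 (inord 2))^-1).
  by have := regularV H; under eq_fun do rewrite mevalXU.
have regs n : regular_on H (fun u => u ord0 (inord 2) ^+ n).
  by apply: regularX; exact: regular_coord.
have regVs n : regular_on H (fun u => (u ord0 (inord 2) ^+ n)^-1).
  by under eq_fun do rewrite -exprVn; apply: regularX.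
have regm : regular_on H (fun u => z ^+ j * u ord0 (inord 2) ^+ p).
  by apply: regularM => //; exact: regular_const.
have regVm : regular_on H (fun u => (z ^+ j * u ord0 (inord 2) ^+ p)^-1).
  by under eq_fun do rewrite invfM; apply: regularM => //; exact: regular_const.
apply: regular_mx_pair; apply: regular_conj_tri => //;
  try exact: regular_const; try exact: regular_coord.
all: by apply: regularM; [exact: regular_coord|apply: regularD => //; exact: regularN].
Qed.

Section Components.
Variables (p t : nat) (z z' : K).
Hypotheses (zp : (2 * p).-primitive_root z) (zt : (2 * t).-primitive_root z').

Let V := repr_variety K (Gpt_gen p t).

Definition trace_component (k k' : nat) : set 'rV[K]_(2 * (2 * 2)) :=
  stratum_pair 2 2 (z ^+ k) (z ^+ k)^-1 (z' ^+ k') (z' ^+ k')^-1.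

(** The eigenvalues are distinct and have the same n-th power (-1)^k. *)
Lemma pow_scalar n (y : K) k (A : 'M[K]_2) : (2 * n).-primitive_root y ->
  (0 < k < n)%N -> \tr A = y ^+ k + (y ^+ k)^-1 -> \det A = y ^+ k * (y ^+ k)^-1 ->
  A ^+ n = ((-1) ^+ k)%:M.
Proof.
move=> yn kn tA dA; have [c [e [-> e1 e2 _]]] := mx2_pow n tA dA.
have yk : y ^+ k ^+ n = (-1) ^+ k by rewrite exprAC (prim_root_half yn).
have c0 : c = 0.
  have ne := prim_root_powV_neq yn kn; apply/eqP.
  have : c * (y ^+ k - (y ^+ k)^-1) = 0.
    rewrite mulrBr; apply/eqP; rewrite subr_eq0; apply/eqP/(addIr e).
    by rewrite -e1 -e2 exprVn yk -exprVn invrN1.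
  by move/eqP; rewrite mulf_eq0 (subr_eq0 (y ^+ k)) (negPf ne) orbF.
by rewrite -yk e1 c0 scale0r mul0r !add0r.
Qed.

Lemma trace_component_sub k k' : (0 < k < p)%N -> (0 < k' < t)%N ->
  odd k = odd k' -> trace_component k k' `<=` V.
Proof.
move=> kp kt okk v [[tA dA] [tB dB]]; rewrite /V repr_variety_pair; split.
- by rewrite dA divff // expf_neq0 // (prim_root_neq0 zp).
- by rewrite dB divff // expf_neq0 // (prim_root_neq0 zt).
by rewrite (pow_scalar zp kp tA dA) (pow_scalar zt kt tB dB) -signr_odd okk signr_odd.
Qed.

Lemma variety_cover : V `<=`
  [set v | mx_of_coords v ord0 *m mx_of_coords v ord_max =
           mx_of_coords v ord_max *m mx_of_coords v ord0] `|`
  \bigcup_(n : 'I_#|trace_index p t|)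
    trace_component (enum_val n).1 (enum_val n).2.
Proof.
move=> v; rewrite /V repr_variety_pair => -[dA dB AB].
have [comm|ncomm] := pselect (mx_of_coords v ord0 *m mx_of_coords v ord_max =
  mx_of_coords v ord_max *m mx_of_coords v ord0); first by left.
right; have [k [k' [kp kt okk tA tB]]] := noncommuting_traces zp zt dA dB AB ncomm.
have /andP[k0 kp'] := kp; have /andP[k'0 kt'] := kt.
have kI : (Ordinal kp', Ordinal kt') \in trace_index p t.
  by rewrite inE /= k0 k'0 okk eqxx.
exists (enum_rank_in kI (Ordinal kp', Ordinal kt')) => //.
rewrite enum_rankK_in //=; split; split=> //.
  by rewrite dA divff // expf_neq0 // (prim_root_neq0 zp).
by rewrite dB divff // expf_neq0 // (prim_root_neq0 zt).
Qed.

Lemma trace_component_noncommuting k k' : (0 < k < p)%N -> (0 < k' < t)%N ->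
  exists2 v, trace_component k k' v &
    mx_of_coords v ord0 *m mx_of_coords v ord_max <>
    mx_of_coords v ord_max *m mx_of_coords v ord0.
Proof.
move=> kp kt; exists (mx_pair (mx2 (z ^+ k) 1 0 (z ^+ k)^-1)
  (mx2 (z' ^+ k') 0 1 (z' ^+ k')^-1)).
  rewrite /trace_component /stratum_pair /= mx_pair_fst mx_pair_snd !tr_mx2 !det_mx2.
  by rewrite !mulr0 !mul0r !subr0.
rewrite mx_pair_fst mx_pair_snd !mul_mx2 => /mx2_inj[/eqP + _ _ _].
rewrite mul0r addr0 mul1r [X in _ == X]mulrC -subr_eq0 addrAC subrr add0r.
by rewrite oner_eq0.
Qed.

Lemma trace_component_inj k k' j j' : (0 < k < p)%N -> (0 < k' < t)%N ->
  (0 < j < p)%N -> (0 < j' < t)%N ->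
  trace_component k k' `<=` trace_component j j' -> k = j /\ k' = j'.
Proof.
move=> kp kt jp jt sub.
have [v vk _] := trace_component_noncommuting kp kt.
have [[tA _] [tB _]] := vk; have [[tA' _] [tB' _]] := sub v vk.
by split; [apply: (prim_root_trace_inj zp)|apply: (prim_root_trace_inj zt)];
  rewrite // -?tA -?tB.
Qed.

(** An irreducible closed subset of V consists of commuting pairs or lies in a
    trace component.  The first kind has no chain of length 4; hence a component of
    dimension 4 is a trace component.  Conversely a larger irreducible set falls
    in one trace component, which is the same one by comparison of traces. *)
Lemma components_of_dim4 : (0 < t)%N -> components_of_dim V 4 =
  [set trace_component (enum_val n).1 (enum_val n).2
    | n in [set: 'I_#|trace_index p t|]].
Proof.
move=> t0; have K0 := Num.Theory.pchar_num K.
have idx (n : 'I_#|trace_index p t|) : [/\ (0 < (enum_val n).1 < p)%N,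
    (0 < (enum_val n).2 < t)%N & odd (enum_val n).1 = odd (enum_val n).2].
  by have := enum_valP n; rewrite inE => /and3P[-> -> /eqP]; rewrite !ltn_ord.
have irr (n : 'I_#|trace_index p t|) :
    irreducible_closed_in V (trace_component (enum_val n).1 (enum_val n).2).
  have [kp kt okk] := idx n; split; first exact: trace_component_sub.
    exact: stratum_pair_closed.
  by apply: stratum_pair_irreducible; rewrite ?(prim_root_powV_neq zp) ?(prim_root_powV_neq zt).
have closed_comm : zariski_closed [set v : 'rV[K]_(2 * (2 * 2)) |
    mx_of_coords v ord0 *m mx_of_coords v ord_max =
    mx_of_coords v ord_max *m mx_of_coords v ord0].
  have reg i j : regular_mx 1 (fun v : 'rV[K]_(2 * (2 * 2)) =>
      mx_of_coords v i *m mx_of_coords v j).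
    by apply: regular_mulmx; apply: regular_mx_of_coords.
  have entry a b := zariski_closed_eq (reg ord0 ord_max a b) (reg ord_max ord0 a b).
  have := zariski_closedI (zariski_closedI (entry ord0 ord0) (entry ord0 ord_max))
    (zariski_closedI (entry ord_max ord0) (entry ord_max ord_max)).
  congr zariski_closed; apply/seteqP; split=> v /=; last by move=> ->.
  move=> [[e1 e2] [e3 e4]]; apply/matrixP => i j.
  have ord2 (a : 'I_2) : a = ord0 \/ a = ord_max.
    by case: (unliftP ord0 a) => [b ->|->]; [right; apply: val_inj; rewrite /= (ord1 b)|left].
  by case: (ord2 i) => ->; case: (ord2 j) => ->.
have dichotomy Z : irreducible_closed_in V Z ->
    (Z `<=` [set v | mx_of_coords v ord0 *m mx_of_coords v ord_max =
                     mx_of_coords v ord_max *m mx_of_coords v ord0]) \/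
    exists n : 'I_#|trace_index p t|, Z `<=` trace_component (enum_val n).1 (enum_val n).2.
  move=> [ZV _ irrZ]; apply: (irreducible_sub_bigcup irrZ closed_comm).
    by move=> n; exact: stratum_pair_closed.
  exact: subset_trans ZV variety_cover.
apply/seteqP; split=> [Z [[irrZ maxZ] [[C chainC] _]]|_ [n _ <-]]; last first.
  have [kp kt okk] := idx n; split; last first.
    by apply: stratum_pair_dim; rewrite ?(prim_root_powV_neq zp) ?(prim_root_powV_neq zt).
  split=> // Z' irrZ' subZ'; apply/seteqP; split=> //.
  case: (dichotomy Z' irrZ') => [comm|[m subm]].
    have [v vk] := trace_component_noncommuting kp kt.
    by case; apply: comm; apply: subZ'.
  have [mp mt _] := idx m.
  have [e e'] := trace_component_inj kp kt mp mt (subset_trans subZ' subm).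
  by rewrite e e'.
have [ZV _ _] := irrZ; have [irrC _] := chainC.
have [CZ _ _] := irrC 4%N (leqnn 4).
case: (dichotomy Z irrZ) => [comm|[n subn]]; last by exists n => //; exact: maxZ.
have sub : C 4%N `<=` V `&` [set v | mx_of_coords v ord0 *m mx_of_coords v ord_max =
    mx_of_coords v ord_max *m mx_of_coords v ord0].
  by move=> v /CZ Zv; split; [exact: ZV|exact: comm].
by have := chain_length_le (commuting_pairs_dim_le t0) chainC sub.
Qed.

Lemma card_components_of_dim4 : (0 < t)%N ->
  (components_of_dim V 4 #= `I_#|trace_index p t|)%card.
Proof.
move=> t0; rewrite (components_of_dim4 t0) (card_eqr card_II).
apply: inj_card_eq => n m _ _ e; apply: enum_val_inj.
have idx (q : 'I_#|trace_index p t|) :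
    (0 < (enum_val q).1 < p)%N /\ (0 < (enum_val q).2 < t)%N.
  by have := enum_valP q; rewrite inE => /and3P[-> -> _]; rewrite !ltn_ord.
have [np nt] := idx n; have [mp mt] := idx m.
have sub : trace_component (enum_val n).1 (enum_val n).2 `<=`
  trace_component (enum_val m).1 (enum_val m).2 by rewrite e.
have [e1 e2] := trace_component_inj np nt mp mt sub.
by case: (enum_val n) (enum_val m) e1 e2 => [a b] [a' b'] /= /val_inj-> /val_inj->.
Qed.

End Components.
End Variety.

Lemma card_odd_ord p : #|[set k : 'I_p | odd k]| = p./2.
Proof.
rewrite cardsE -sum1_card big_mkcond /=.
elim: p => [|p IH]; first by rewrite big_ord0.
rewrite big_ord_recr /= IH unfold_in /=; case: ifP; lia.
Qed.

Lemma card_even_pos_ord p : #|[set k : 'I_p | (0 < k)%N && ~~ odd k]| = p.-1./2.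
Proof.
rewrite cardsE -sum1_card big_mkcond /=.
elim: p => [|p IH]; first by rewrite big_ord0.
rewrite big_ord_recr /= IH unfold_in /=; case: ifP; lia.
Qed.

Lemma card_trace_index p t :
  #|trace_index p t| = (p./2 * t./2 + p.-1./2 * t.-1./2)%N.
Proof.
rewrite -!card_even_pos_ord -!card_odd_ord -!cardsX.
rewrite -cardsUI [X in (_ + X)%N](_ : _ = 0%N) ?addn0.
  apply: eq_card => -[k k']; rewrite !inE /=.
  case: k k' => [[|k] kp] [k' kt] /=; first by [].
  by case: k' {kt} => [|k'] /=; rewrite ?andbF //; case: (odd k); case: (odd k').
by apply: eq_card0 => -[k k']; rewrite !inE /=; case: (odd k); rewrite /= ?andbF.
Qed.

Theorem theoremA (R : realType) (p t : nat) (hp : (1 < p)%N) (ht : (1 < t)%N) :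
  exists C4 : nat,
    (components_of_dim (repr_variety R[i] (Gpt_gen p t)) 4 #= `I_C4)%card /\
    (~~ odd p /\ ~~ odd t ->
      C4%:R = ((p%:R - 2%:R) * (t%:R - 2%:R) + p%:R * t%:R) / 4%:R :> rat) /\
    (odd p \/ odd t ->
      C4%:R = (p%:R - 1) * (t%:R - 1) / 2%:R :> rat).
Proof.
have [p2 t2] : (0 < 2 * p)%N /\ (0 < 2 * t)%N by lia.
have [z zp] := prim_root_exists R[i] p2; have [z' zt] := prim_root_exists R[i] t2.
exists #|trace_index p t|; split; first exact: card_components_of_dim4 zp zt (ltnW ht).
rewrite card_trace_index; have pE := odd_double_half p; have tE := odd_double_half t.
have predE n : (1 < n)%N -> n.-1./2 = (n./2 - ~~ odd n)%N.
  by case: n => // n _; rewrite /=; lia.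
rewrite !predE //; move: (p./2) (t./2) pE tE => a b pE tE.
have [a0 b0] : (0 < a)%N /\ (0 < b)%N by lia.
rewrite -pE -tE -!muln2 !oddD !oddM !andbF !addbF !oddb.
split=> [[/negPf-> /negPf->]|]; rewrite /= ?add0n.
  rewrite natrD !natrM !natrB //; by field.
case: (odd p) => [_|[//|->]] /=; first case: (odd t) => /=.
all: rewrite ?subn0 ?add0n natrD !natrM ?natrB // ?natrD ?natrM; by field.
Qed.
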